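(* Let $q$ be a prime power and let $f\in\mathbb{F}_q[T][X]$ be irreducible with $d=\deg_X f\ge 2$. Then, as $n\to\infty$ (with $f$ and $q$ fixed), $$\deg L_f(n)\lesssim c_f(d-1)\,n q^n .$$
   Context: $M_n$ denotes the set of monic polynomials of degree $n$ in $\mathbb{F}_q[T]$. For $n$ large enough that $f(Q)\neq 0$ for all $Q\in M_n$, set $L_f(n)=\mathrm{lcm}(f(Q):Q\in M_n)\in\mathbb{F}_q[T]$; $\deg$ denotes degree in $T$. Let $V_f=\{g\in\mathbb{F}_q[T]: f(X+g)=f(X)\}$ (a finite set) and $c_f=1/|V_f|$. For positive functions $A(n),B(n)$, $A\lesssim B$ means $\limsup_{n\to\infty}A(n)/B(n)\le 1$. *)

(* Defs.v *)
From HB Require Import structures.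
From mathcomp Require Import all_boot all_order all_algebra.
From mathcomp Require Import finmap.
From mathcomp Require Import all_classical all_reals all_analysis.

Set Implicit Arguments.
Unset Strict Implicit.
Unset Printing Implicit Defensive.

Import Order.TTheory GRing.Theory Num.Theory.
Local Open Scope ring_scope.

(* An irreducible element of an integral domain. For R = {poly {poly F}} this
   differs from [irreducible_poly], which is insensitive to constant factors
   in {poly F}. *)
Definition irreducible_elt (R : idomainType) (x : R) : Prop :=
  [/\ x != 0, x \isn't a GRing.unit &
      forall y z : R, x = y * z -> y \is a GRing.unit \/ z \is a GRing.unit].

Definition degp (R : nzSemiRingType) (p : {poly R}) : nat := (size p).-1.

Section Lcm.
Variable F : fieldType.
Implicit Types p r s : {poly F}.

(* Like [gcdp], defined up to a nonzero constant factor. *)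
Definition lcmp p r : {poly F} := (p * r) %/ gcdp p r.

Lemma dvdp_lcm p r s : (lcmp p r %| s) = (p %| s) && (r %| s).
Proof.
have [->|p0] := eqVneq p 0.
  rewrite /lcmp mul0r div0p !dvd0p; apply/idP/andP => [/eqP->|[]//].
  by rewrite eqxx dvdp0.
have g0 : gcdp p r != 0 by rewrite gcdp_eq0 negb_and p0.
have gM : gcdp p r %| p * r by rewrite dvdp_mulr ?dvdp_gcdl.
have E : lcmp p r * gcdp p r = p * r by rewrite divpK.
rewrite -(dvdp_mul2r _ _ g0) E.
rewrite (eqp_dvdr _ (mulp_gcdr _ _ _)) dvdp_gcd.
rewrite [s * p]mulrC dvdp_mul2l // [p * r]mulrC [s * r]mulrC.
have [->|r0] := eqVneq r 0; last by rewrite dvdp_mul2l // andbC.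
by rewrite !mul0r dvdpp dvd0p /=; case: eqP => [->|]; rewrite ?dvdp0 ?andbF.
Qed.

Lemma dvdp_biglcm (I : finType) (P : pred I) (G : I -> {poly F}) s :
  (\big[lcmp/1]_(i | P i) G i %| s) = [forall (i | P i), G i %| s].
Proof.
rewrite -big_andE; elim/big_rec2: _ => [|i b r _ <-]; first by rewrite dvd1p.
by rewrite dvdp_lcm.
Qed.

End Lcm.

Section Values.
Variable F : finFieldType.
Implicit Types (f : {poly {poly F}}) (g : {poly F}) (n : nat).

Definition monic_of_deg n : {set {poly_(n.+1) F}} :=
  [set Q : {poly_(n.+1) F} | (val Q \is monic) && (degp (val Q) == n)].

Lemma monic_of_degP n g :
  reflect (exists2 Q, Q \in monic_of_deg n & val Q = g)
          ((g \is monic) && (degp g == n)).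
Proof.
apply: (iffP idP) => [H|[Q]]; last by rewrite inE => ? <-.
have sg : (size g <= n.+1)%N.
  by case/andP: H => _ /eqP <-; rewrite /degp leqSpred.
by exists (@NPoly F n.+1 g sg) => //; rewrite inE.
Qed.

Lemma irreducible_horner_neq0 f g :
  irreducible_elt f -> (2 <= degp f)%N -> f.[g] != 0.
Proof.
move=> [f0 _ firr] df; apply/negP => /factor_theorem[h fE].
have h0 : h != 0 by apply: contraNneq f0 => h0; rewrite fE h0 mul0r.
have sf : size f = (size h).+1.
  by rewrite fE size_Mmonic ?monicXsubC // size_XsubC addn2.
case: (firr _ _ fE); rewrite poly_unitE => /andP[/eqP sz _].
  by move: df; rewrite /degp sf sz.
by move: sz; rewrite size_XsubC.
Qed.

(* For f irreducible of degree at least 2 in X, no value f(Q) is zero, whatever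
   n is: see [irreducible_horner_neq0]. *)
Definition Lf f n : {poly F} :=
  \big[@lcmp F/1]_(Q in monic_of_deg n) f.[val Q].

Definition Vf f : set {poly F} := [set g | f \Po ('X + g%:P) = f]%classic.

Lemma finite_Vf f : (1 < size f)%N -> finite_set (Vf f).
Proof.
move=> sf; pose h := f - (f.[0])%:P.
have h0 : h != 0.
  apply/eqP => /subr0_eq fE.
  by move: sf; rewrite fE size_polyC; case: (_ != 0).
have rootV g : Vf f g -> root h g.
  move=> /(congr1 (fun p => p.[0])); rewrite horner_comp !hornerE => E.
  by rewrite /root /h !hornerE E subrr.
apply: contrapT => /(infinite_set_fset (size h))[X XV].
rewrite leqNgt => /negP; apply.
apply: (@max_poly_roots _ h (enum_fset X)) => //; last exact: fset_uniq.
by apply/allP => g gX; apply/rootV/XV.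
Qed.

(* [fset_set] returns the empty set on infinite sets; by [finite_Vf] this does
   not happen for f of positive degree in X. *)
Definition cf (R : realType) f : R := (#|` fset_set (Vf f)|%:R)^-1.

End Values.

Definition asymp_le (R : realType) (A B : nat -> R) : Prop :=
  (limn_esup (fun n => (A n / B n)%:E) <= 1%:E)%E.

(* Main.v *)
Require Import Defs.
From HB Require Import structures.
From mathcomp Require Import all_boot all_order all_algebra.
From mathcomp Require Import finmap.
From mathcomp Require Import all_classical all_reals all_analysis.
From mathcomp Require Import qfpoly closed_field separable finfield.
From mathcomp Require Import ring lra zify.
Import Order.TTheory GRing.Theory Num.Theory.
Local Open Scope ring_scope.
Set Implicit Arguments.
Unset Strict Implicit.
Unset Printing Implicit Defensive.

(** Write [q = #|F|], [d = degp f], and let [rho P] be the number of roots of [f]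
    modulo a prime [P].

    Primes of degree at most [n] contribute only [o(n q^n)] to the degree of the
    lcm, because each of them contributes [O(n)]. For the larger primes, the lcm
    divides the product of the large parts of the distinct values [f(Q)], and
    each value is taken at least [#|Vf f|] times. The product of all the [f(Q)]
    has degree [d n q^n + O(q^n)], and its part supported on primes of degree at
    most [n] has degree at least the sum of [rho P * degp P * q^(n - degp P)].
    So everything rests on the Mertens-type lower bound
      [sum_(degp P <= n) rho P * degp P / q^(degp P) >= (1 - o(1)) n].

    Replacing [f(X)] by [f(X^(1/p^e))] and rescaling [X], one may take [f] monic
    and separable in [X]. Let [N] be the norm of [F[T][X]/(f)] over [F[T]] and
    consider the box of the [g] of degree less than [d] in [X] and less than [m]
    in [T]. For most [g], [N g] has degree at least [d m - O(1)]. On the other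
    hand, for most [g], [N g] is up to a factor of bounded degree a product of
    distinct large primes, each of which comes from a common root of [f] and [g]
    modulo [P]: having [P^2] divide [N g] forces [g] into one of boundedly many
    lattices of index [q^(2 degp P)]. Finally a root [x] of [f] modulo [P] is a
    root of [q^(d m - degp P)] elements of the box as long as
    [degp P <= d m - O(1)]. Counting pairs [(g, P)] gives the bound. *)

(** * Monic primes of [F[T]], their valuations and their number *)

Section PolyPrimes.
Variable F : finFieldType.
Implicit Types (P a b : {poly F}) (s : seq {poly F}).

Definition prime_poly P := irreducibleb P && (P \is monic).

Lemma prime_poly_irr P : prime_poly P -> irreducible_poly P.
Proof. by case/andP => /irreducibleP. Qed.

Lemma prime_poly_monic P : prime_poly P -> P \is monic.
Proof. by case/andP. Qed.

Lemma prime_poly_neq0 P : prime_poly P -> P != 0.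
Proof. by move/prime_poly_monic/monic_neq0. Qed.

Lemma prime_poly_deg_gt0 P : prime_poly P -> (0 < degp P)%N.
Proof. by move/prime_poly_irr => [+ _]; rewrite /degp; case: size => [|[]]. Qed.

Lemma prime_poly_size P : prime_poly P -> size P = (degp P).+1.
Proof. by move/prime_poly_neq0; rewrite /degp -size_poly_gt0 => /prednK. Qed.

Lemma prime_poly_dvdM P a b :
  prime_poly P -> (P %| a * b) = (P %| a) || (P %| b).
Proof.
move=> /prime_poly_irr irrP; apply/idP/orP => [|[]]; last 2 first.
- exact: dvdp_mulr.
- exact: dvdp_mull.
have [|nPa] := boolP (P %| a); first by left.
by rewrite Gauss_dvdpr ?irreducible_poly_coprime //; right.
Qed.

Lemma prime_poly_dvdX P a k : prime_poly P -> P %| a ^+ k -> P %| a.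
Proof.
move=> pP; elim: k => [|k IHk]; last first.
  by rewrite exprS prime_poly_dvdM // => /orP[].
rewrite expr0 dvdp1 => /eqP sP.
by have := prime_poly_deg_gt0 pP; rewrite /degp sP.
Qed.

Lemma prime_poly_ndvd1 P : prime_poly P -> ~~ (P %| 1).
Proof.
move=> pP; rewrite dvdp1; apply/eqP => sP.
by have := prime_poly_deg_gt0 pP; rewrite /degp sP.
Qed.

Lemma prime_poly_dvd_eq P Q : prime_poly P -> prime_poly Q -> P %| Q -> P = Q.
Proof.
move=> pP pQ; case: (prime_poly_irr pQ) => _ /(_ P) /[apply].
have := prime_poly_deg_gt0 pP; rewrite /degp; case: size => [|[|n]] // _ /(_ isT).
by rewrite eqp_monic ?prime_poly_monic // => /eqP.
Qed.

Lemma ex_prime_poly_dvd a : (1 < size a)%N -> exists2 P, prime_poly P & P %| a.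
Proof.
have [n] := ubnP (size a); elim: n a => // n IHn a sa a1.
have a0 : a != 0 by rewrite -size_poly_gt0 ltnW.
have [/irreducibleP irra|] := boolP (irreducibleb a).
  have la0 : lead_coef a != 0 by rewrite lead_coef_eq0.
  exists ((lead_coef a)^-1 *: a); last by rewrite dvdpZl ?invr_eq0.
  apply/andP; split; last by rewrite monicE lead_coefZ mulVf.
  apply/irreducibleP; split; first by rewrite size_scale ?invr_eq0.
  move=> r sr; rewrite dvdpZr ?invr_eq0 // => ra.
  case: irra => _ /(_ r sr ra) ra'.
  by rewrite (eqp_trans ra') // eqp_sym eqp_scale ?invr_eq0.
move=> /irreducibleP nirr.
suff [r [sr ra]] : exists r : {poly F}, (1 < size r < size a)%N /\ r %| a.
  case/andP: sr => r1 sra; have [P pP Pr] := IHn r (leq_trans sra sa) r1.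
  by exists P => //; apply: dvdp_trans ra.
apply: contrapT => nex; apply: nirr; split=> // r sr ra.
rewrite -dvdp_size_eqp // eqn_leq dvdp_leq // leqNgt; apply/negP => lt.
apply: nex; exists r; split => //; rewrite lt andbT.
have : r != 0 by apply: contraNneq a0 => r0; move: ra; rewrite r0 dvd0p.
by rewrite -size_poly_gt0; move: sr; case: size => [|[]].
Qed.

Lemma prime_poly_valuation P a : prime_poly P -> a != 0 ->
  exists e b, a = b * P ^+ e /\ ~~ (P %| b).
Proof.
move=> pP; have [n] := ubnP (size a); elim: n a => // n IHn a sa a0.
have [/dvdpP[b ab]|nPa] := boolP (P %| a); last by exists 0, a; rewrite mulr1.
have b0 : b != 0 by apply: contraNneq a0 => b0; rewrite ab b0 mul0r.
have [|e [c [bc nPc]]] := IHn b _ b0; last first.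
  by exists e.+1, c; rewrite ab bc exprSr mulrA.
suff : (size b < size a)%N by move=> ba; rewrite -ltnS (leq_trans _ sa).
rewrite ab size_mul ?(prime_poly_neq0 pP) // (prime_poly_size pP) addnS /=.
by rewrite -[X in (X < _)%N]addn0 ltn_add2l prime_poly_deg_gt0.
Qed.

Lemma prime_poly_factor s a : uniq s -> all prime_poly s -> a != 0 ->
  exists (e : {poly F} -> nat) b,
    [/\ a = b * \prod_(P <- s) P ^+ e P, {in s, forall P, ~~ (P %| b)} &
        {in s, forall P, (P %| a) = (0 < e P)%N}].
Proof.
elim: s a => [|P s IHs] a /=.
  by exists (fun=> 0%N), a; rewrite big_nil mulr1.
move=> /andP[Ps us] /andP[pP ps] a0.
have [k [c [ac nPc]]] := prime_poly_valuation pP a0.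
have c0 : c != 0 by apply: contraNneq a0 => c0; rewrite ac c0 mul0r.
have [e [b [cb nb es]]] := IHs c us ps c0.
exists (fun Q => if Q == P then k else e Q), b; split.
- rewrite big_cons eqxx ac [in LHS]cb -mulrA; congr (_ * _).
  rewrite mulrC; congr (_ * _); apply: eq_big_seq => Q Qs.
  by case: eqP => // QP; rewrite -QP Qs in Ps.
- move=> Q; rewrite inE => /orP[/eqP ->|]; last exact: nb.
  by apply: contraNN nPc => Pb; rewrite cb dvdp_mulr.
- move=> Q; rewrite inE => /orP[/eqP ->|Qs]; rewrite ?eqxx.
    rewrite ac prime_poly_dvdM // (negPf nPc) /=; case: k {ac} => [|k].
      by rewrite expr0 (negPf (prime_poly_ndvd1 pP)).
    by rewrite exprS dvdp_mulr.
  have QP : Q != P by apply: contraNneq Ps => <-.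
  have pQ : prime_poly Q by apply: (allP ps).
  rewrite (negPf QP) -es // ac prime_poly_dvdM //.
  have [//|_ /=] := boolP (Q %| c); apply: contraNF QP => /(prime_poly_dvdX pQ).
  by move/(prime_poly_dvd_eq pQ pP) => ->.
Qed.

(** Size at most [n.+1] means degree at most [n], and such polynomials form a finite type, so the
    primes among them can be listed. *)
Definition primes_upto n : seq {poly F} :=
  [seq val Q | Q <- enum {poly_n.+1 F} & prime_poly (val Q)].

Lemma primes_upto_uniq n : uniq (primes_upto n).
Proof. by rewrite (map_inj_uniq val_inj) filter_uniq ?enum_uniq. Qed.

Lemma mem_primes_upto n P :
  (P \in primes_upto n) = prime_poly P && (degp P <= n)%N.
Proof.
apply/mapP/andP => [[Q]|[pP dP]].
  rewrite mem_filter mem_enum andbT => pQ ->; split=> //.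
  by rewrite -ltnS -prime_poly_size //; apply: size_npoly.
have sP : (size P <= n.+1)%N by rewrite (prime_poly_size pP) ltnS.
by exists (NPoly sP) => //; rewrite mem_filter pP mem_enum.
Qed.

Lemma all_primes_upto n : all prime_poly (primes_upto n).
Proof. by apply/allP => P; rewrite mem_primes_upto => /andP[]. Qed.

Lemma degpM a b : a != 0 -> b != 0 -> degp (a * b) = (degp a + degp b)%N.
Proof.
move=> a0 b0; rewrite /degp size_mul //.
by move: a0 b0; rewrite -!size_poly_gt0; case: size => // m; case: size => // k; rewrite addnS.
Qed.

Lemma degp_dvd a b : b != 0 -> a %| b -> (degp a <= degp b)%N.
Proof.
by move=> b0 /dvdp_leq => /(_ b0); rewrite /degp; do 2 case: size => //.
Qed.

Lemma degpX a k : degp (a ^+ k) = (degp a * k)%N.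
Proof.
have [->|a0] := eqVneq a 0.
  by rewrite /degp; case: k => [|k]; rewrite ?expr0 ?exprS ?mul0r ?size_poly1 ?size_poly0 ?muln0 ?mul0n.
by rewrite /degp size_exp.
Qed.

Lemma degp_prod (I : eqType) (r : seq I) (G : I -> {poly F}) :
  {in r, forall i, G i != 0} ->
  degp (\prod_(i <- r) G i) = (\sum_(i <- r) degp (G i))%N.
Proof.
elim: r => [|i r IHr] G0; first by rewrite !big_nil /degp size_poly1.
have Gr : {in r, forall j, G j != 0} by move=> j jr; rewrite G0 // inE jr orbT.
rewrite !big_cons degpM ?IHr ?G0 ?mem_head // prodf_seq_neq0.
by apply/allP => j /Gr.
Qed.

Lemma prod_primes_dvd s a : uniq s -> all prime_poly s ->
  {in s, forall P, P %| a} -> \prod_(P <- s) P %| a.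
Proof.
elim: s => [|P s IHs] /=; first by rewrite big_nil dvd1p.
move=> /andP[Ps us] /andP[pP ps] da; rewrite big_cons Gauss_dvdp.
  by rewrite da ?mem_head // IHs // => Q Qs; apply: da; rewrite inE Qs orbT.
rewrite (irreducible_poly_coprime _ (prime_poly_irr pP)).
apply/negP; elim: s {IHs da us} Ps ps => [|Q s IHs] /=.
  by rewrite big_nil (negPf (prime_poly_ndvd1 pP)).
rewrite inE negb_or => /andP[PQ Ps] /andP[pQ ps]; rewrite big_cons.
rewrite prime_poly_dvdM // => /orP[/(prime_poly_dvd_eq pP pQ) PQ'|].
  by rewrite PQ' eqxx in PQ.
exact: IHs.
Qed.

(** The residue field modulo [P] has [#|F| ^ degp P] elements, so raising to that power fixes each
    of them, in particular the class of ['X]. *)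
Lemma prime_poly_dvd_XqX P :
  prime_poly P -> P %| 'X^(#|F| ^ degp P) - 'X.
Proof.
move=> pP; have mi : monic_irreducible_poly P.
  by split; [apply: prime_poly_irr | apply: prime_poly_monic].
have E := expf_card (in_qpoly P 'X : {poly %/ P with mi}).
rewrite card_qfpoly in E.
have : in_qpoly P ('X^(#|F| ^ degp P) - 'X) = 0.
  by rewrite rmorphB rmorphXn /=; apply/eqP; rewrite subr_eq0; apply/eqP.
move/(congr1 val) => /=; rewrite mk_monicE // => E0.
by rewrite /dvdp Pdiv.IdomainMonic.modpE ?prime_poly_monic // E0.
Qed.

(** Distinct primes of degree [r] all divide ['X^(#|F| ^ r) - 'X], hence so does their product; the
    bound compares degrees. *)
Lemma card_primes_of_deg n r : (0 < r)%N ->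
  (r * count (fun P => degp P == r) (primes_upto n) <= #|F| ^ r)%N.
Proof.
move=> r0; rewrite -size_filter; set s := [seq _ <- _ | _].
have ms P : P \in s -> prime_poly P /\ degp P = r.
  by rewrite mem_filter mem_primes_upto => /and3P[/eqP].
have q1 := card_finNzRing_gt1 F.
have q1r : (1 < #|F| ^ r)%N by rewrite -(exp1n r) ltn_exp2r.
have sz : size ('X^(#|F| ^ r) - 'X : {poly F}) = (#|F| ^ r).+1.
  by rewrite size_polyDl ?size_polyXn // size_polyN size_polyX ltnS.
have n0 : 'X^(#|F| ^ r) - 'X != 0 :> {poly F} by rewrite -size_poly_gt0 sz.
have := @prod_primes_dvd s ('X^(#|F| ^ r) - 'X) _ _ _.
move=> /(_ (filter_uniq _ (primes_upto_uniq n))) /(_ _)/(_ _)/(degp_dvd n0).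
rewrite /degp sz /= => H; apply: leq_trans (H _ _); last 2 first.
- by apply/allP => P /ms[].
- by move=> P /ms[pP <-]; apply: prime_poly_dvd_XqX.
rewrite -/(degp _) degp_prod; last by move=> P /ms[/prime_poly_neq0].
rewrite (@eq_big_seq _ _ _ _ _ _ (fun=> r)); last first.
  by move=> P /ms[].
by rewrite big_const_seq count_predT iter_addn_0 mulnC.
Qed.

(* The part of [a] composed of the primes of [s] divides the product on the
   right, because a prime [P] occurs in [a] at most [D %/ degp P] times. *)
Lemma prime_poly_cofactor s a D : uniq s -> all prime_poly s -> a != 0 ->
  (degp a <= D)%N ->
  exists b, [/\ b != 0, a %| b * \prod_(P <- s) P ^+ (D %/ degp P) &
    (degp b + \sum_(P <- s | (P %| a)%R) degp P <= degp a)%N].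
Proof.
move=> us ps a0 aD; have [e [b [ab nb es]]] := prime_poly_factor us ps a0.
have b0 : b != 0 by apply: contraNneq a0 => b0; rewrite ab b0 mul0r.
have p0 : \prod_(P <- s) P ^+ e P != 0.
  by apply: contraNneq a0 => p0; rewrite ab p0 mulr0.
have degE : degp a = (degp b + \sum_(P <- s) degp P * e P)%N.
  rewrite [in LHS]ab degpM //; congr addn.
  rewrite degp_prod; first by apply: eq_bigr => P _; rewrite degpX.
  by move=> P Ps; rewrite expf_neq0 // prime_poly_neq0 // (allP ps).
exists b; split=> //.
  rewrite ab dvdp_mul2l // big_seq [X in _ %| X]big_seq.
  apply: (big_ind2 (fun x y : {poly F} => x %| y)) => //.
    by move=> *; apply: dvdp_mul.
  move=> P Ps; rewrite dvdp_exp2l // leq_divRL; last first.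
    by apply: prime_poly_deg_gt0; apply: (allP ps).
  apply: leq_trans aD; rewrite degE mulnC (big_rem P) //= addnCA leq_addr //.
rewrite degE leq_add2l [X in (_ <= X)%N](bigID (fun P => P %| a)) /=.
apply: leq_trans (leq_addr _ _).
rewrite big_seq_cond [X in (_ <= X)%N]big_seq_cond; apply: leq_sum => P /andP[Ps].
by rewrite es //; case: (e P) => // k _; rewrite mulnS leq_addr.
Qed.

(** Every prime factor of [a] has degree at most [n], so once the listed primes are removed only a
    constant is left. *)
Lemma degp_le_prime_valuations n a (m : {poly F} -> nat) : a != 0 ->
  (degp a <= n)%N ->
  (forall P, prime_poly P -> ~~ (P ^+ (m P).+1 %| a)) ->
  (degp a <= \sum_(P <- primes_upto n | (P %| a)%R) m P * degp P)%N.
Proof.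
move=> a0 an hm.
have [e [b [ab nb es]]] := prime_poly_factor (primes_upto_uniq n) (all_primes_upto n) a0.
have b0 : b != 0 by apply: contraNneq a0 => b0; rewrite ab b0 mul0r.
have b1 : degp b = 0%N.
  apply/eqP; rewrite -leqn0 leqNgt; apply/negP => db.
  have [|P pP Pb] := @ex_prime_poly_dvd b; first by move: db; rewrite /degp; case: size => [|[]].
  suff /nb : P \in primes_upto n by rewrite Pb.
  rewrite mem_primes_upto pP /=; apply: leq_trans an; apply: degp_dvd => //.
  by apply: dvdp_trans Pb _; rewrite ab dvdp_mulr.
have p0 : \prod_(P <- primes_upto n) P ^+ e P != 0.
  by apply: contraNneq a0 => p0; rewrite ab p0 mulr0.
have -> : degp a = (\sum_(P <- primes_upto n) degp P * e P)%N.
  rewrite [in LHS]ab degpM // b1 add0n degp_prod.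
    by apply: eq_bigr => P _; rewrite degpX.
  move=> P /(allP (all_primes_upto n)) pP.
  by rewrite expf_neq0 // prime_poly_neq0.
rewrite (bigID (fun P => P %| a)) /= [X in (_ + X)%N]big1_seq ?addn0; last first.
  by move=> P /andP[Pa Ps]; move: Pa; rewrite es // lt0n negbK => /eqP ->; rewrite muln0.
rewrite big_seq_cond [X in (_ <= X)%N]big_seq_cond; apply: leq_sum => P /andP[Ps _].
rewrite mulnC leq_mul2r; apply/orP; right.
have /hm := allP (all_primes_upto n) _ Ps; apply: contraNT; rewrite -ltnNge => lt.
rewrite ab (big_rem P) //= dvdp_mull // dvdp_mulr // dvdp_exp2l //.
Qed.

End PolyPrimes.

(** * Norms from [A[X]/(f)] as determinants *)

Section Companion.
Variables (n : nat).

(* Transposed variant of [companionmx], with a size that is a successor;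
   it is the matrix of multiplication by X modulo f. *)
Definition mulX_mx (A : nzRingType) (f : {poly A}) : 'M[A]_n.+1 :=
  \matrix_(i, j) if j == ord_max then - f`_i else (i == j.+1 :> nat)%:R.

(** For [f] monic of degree [n.+1], this is the norm from [A[X]/(f)] to [A] of the class of [g]. *)
Definition norm_mod (A : comNzRingType) (f g : {poly A}) : A :=
  \det (horner_mx (mulX_mx f) g).

Lemma map_mulX_mx (A B : nzRingType) (phi : {rmorphism A -> B}) (f : {poly A}) :
  map_mx phi (mulX_mx f) = mulX_mx (map_poly phi f).
Proof.
apply/matrixP => i j; rewrite !mxE coef_map.
by case: eqP => _; rewrite ?rmorphN ?rmorph_nat.
Qed.

Lemma map_norm_mod (A B : comNzRingType) (phi : {rmorphism A -> B})
    (f g : {poly A}) :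
  phi (norm_mod f g) = norm_mod (map_poly phi f) (map_poly phi g).
Proof. by rewrite /norm_mod -det_map_mx map_horner_mx map_mulX_mx. Qed.

Section Ring.
Variables (A : comNzRingType) (f : {poly A}).
Hypotheses (f_monic : f \is monic) (size_f : size f = n.+2).
Implicit Types (g : {poly A}) (x : A).

Definition pow_row x : 'rV[A]_n.+1 := \row_j x ^+ j.

(** At a root [x] of [f], the row of powers of [x] is thus a left eigenvector. Keeping the error
    term makes this usable modulo a divisor of [f.[x]]. *)
Lemma pow_row_mulX x :
  pow_row x *m mulX_mx f = x *: pow_row x - f.[x] *: delta_mx 0 ord_max.
Proof.
apply/rowP => j; rewrite !mxE eqxx /=.
have [->|jn] := eqVneq j ord_max.
  rewrite mulr1 horner_coef size_f [in RHS]big_ord_recr /=.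
  have -> : f`_n.+1 = 1 by move/monicP: f_monic; rewrite lead_coefE size_f.
  rewrite mul1r exprS addrC opprD addrNK -sumrN; apply: eq_bigr => i _.
  by rewrite !mxE eqxx mulrN mulrC.
have lt : (j.+1 < n.+1)%N.
  by rewrite ltn_neqAle ltn_ord andbT eqSS; apply: contraNneq jn => E; apply/eqP/val_inj.
rewrite mulr0 subr0 (bigD1 (Ordinal lt)) //= !mxE (negPf jn) eqxx mulr1 big1 ?addr0 ?exprS //.
move=> i; rewrite -val_eqE /= => ij; rewrite !mxE (negPf jn) (negPf ij) mulr0 //.
Qed.

Lemma pow_row_horner_mx g x : exists w : 'rV[A]_n.+1,
  pow_row x *m horner_mx (mulX_mx f) g = g.[x] *: pow_row x + f.[x] *: w.
Proof.
elim/poly_ind: g => [|g c [w IHg]].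
  by exists 0; rewrite rmorph0 mulmx0 horner0 scale0r scaler0 addr0.
exists (w *m mulX_mx f - g.[x] *: delta_mx 0 ord_max).
rewrite rmorphD rmorphM /= horner_mx_C horner_mx_X mulmxDr mul_mx_scalar.
rewrite mulmxA IHg mulmxDl -!scalemxAl pow_row_mulX hornerMXaddC.
by set u := w *m _; apply/rowP => i; rewrite !mxE; ring.
Qed.

(** Multiplying the approximate eigenvector relation by the adjugate turns the matrix into its
    determinant; the first coordinate of [pow_row x] is 1. *)
Lemma norm_mod_in_ideal g x : exists a b, norm_mod f g = g.[x] * a + f.[x] * b.
Proof.
have [w E] := pow_row_horner_mx g x.
have := congr1 (mulmxr (\adj (horner_mx (mulX_mx f) g))) E.
rewrite /= -mulmxA mul_mx_adj mul_mx_scalar mulmxDl -!scalemxAl.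
move: (_ *m \adj _) (_ *m \adj _) => u v /rowP/(_ ord0).
by rewrite !mxE expr0 mulr1 => E0; exists (v 0 ord0), (u 0 ord0).
Qed.

Lemma mulX_mx_exp (j : 'I_n.+1) :
  mulX_mx f ^+ j *m delta_mx ord0 0 = delta_mx j 0 :> 'cV_n.+1.
Proof.
case: j => j; elim: j => [|j IHj] lt /=.
  by rewrite expr0 mul1mx; congr delta_mx; apply: val_inj.
rewrite exprS -mulmxA (IHj (ltnW lt)) -colE; apply/colP => i.
rewrite !mxE andbT -val_eqE /= ltn_eqF //.
Qed.

Lemma horner_mx_coef (M : 'M[A]_n.+1) g :
  horner_mx M g = \sum_(i < size g) g`_i *: M ^+ i.
Proof.
rewrite -[g in LHS]coefK poly_def rmorph_sum; apply: eq_bigr => i _.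
by rewrite /= horner_mxZ rmorphXn /= horner_mx_X.
Qed.

(** The first basis vector is cyclic: it is killed by [f], and its images under the powers of the
    matrix, which commute with [f] of the matrix, are the other basis vectors. *)
Lemma horner_mulX_mx0 : horner_mx (mulX_mx f) f = 0.
Proof.
set M := mulX_mx f.
have E0 : horner_mx M f *m delta_mx ord0 0 = 0 :> 'cV_n.+1.
  rewrite horner_mx_coef size_f big_ord_recr mulmxDl mulmx_suml /=.
  have -> : f`_n.+1 = 1 by move/monicP: f_monic; rewrite lead_coefE size_f.
  rewrite scale1r exprS -mulmxA (mulX_mx_exp ord_max) -colE.
  apply/colP => i; rewrite !mxE eqxx summxE (bigD1 i) //= -scalemxAl mulX_mx_exp.
  rewrite !mxE !eqxx mulr1 big1 ?addr0 ?subrr // => k ki.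
  by rewrite -scalemxAl mulX_mx_exp !mxE eqxx andbT eq_sym (negPf ki) mulr0.
apply/matrixP => i j; rewrite [RHS]mxE.
have -> : horner_mx M f i j = (horner_mx M f *m delta_mx j 0 : 'cV_n.+1) i 0.
  by rewrite -colE mxE.
rewrite -(mulX_mx_exp j) mulmxA.
have -> : horner_mx M f *m M ^+ j = M ^+ j *m horner_mx M f.
  exact/commrX/comm_horner_mx.
by rewrite -mulmxA E0 mulmx0 mxE.
Qed.

Lemma norm_modM g1 g2 : norm_mod f (g1 * g2) = norm_mod f g1 * norm_mod f g2.
Proof. by rewrite /norm_mod rmorphM det_mulmx. Qed.

(** Along a line of constant shifts, the norm is therefore given by a monic polynomial of degree
    [n.+1] in the shift. All bounds on the frequency of exceptional norms start from this. *)
Lemma norm_mod_shift g s :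
  norm_mod f (g + s%:P) = (char_poly (- horner_mx (mulX_mx f) g)).[s].
Proof.
rewrite /norm_mod rmorphD /= horner_mx_C -horner_evalE /char_poly -det_map_mx.
congr (\det _); apply/matrixP => i j.
by rewrite !mxE /= horner_evalE !hornerE hornerMn hornerX opprK addrC.
Qed.

End Ring.

Section Split.
Variables (k : fieldType) (f : {poly k}).
Hypotheses (f_monic : f \is monic) (size_f : size f = n.+2).
Implicit Types (g : {poly k}).

(** The Vandermonde matrix of the roots is invertible and diagonalizes multiplication by [g]. *)
Lemma norm_mod_split (y : 'I_n.+1 -> k) g : injective y ->
  (forall i, root f (y i)) -> norm_mod f g = \prod_i g.[y i].
Proof.
move=> yI fy; pose V := (Vandermonde n.+1 (\row_i y i))^T.
have rowV i : row i V = pow_row (y i) by apply/rowP => j; rewrite !mxE.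
have V0 : \det V != 0.
  rewrite det_tr det_Vandermonde; apply/prodf_neq0 => i _; apply/prodf_neq0 => j ij.
  by rewrite !mxE subr_eq0 (inj_eq yI) -val_eqE /= gtn_eqF.
apply: (mulfI V0); rewrite /norm_mod -det_mulmx.
have -> : V *m horner_mx (mulX_mx f) g = diag_mx (\row_i g.[y i]) *m V.
  apply/row_matrixP => i; rewrite !row_mul rowV.
  have [w ->] := pow_row_horner_mx f_monic size_f g (y i).
  rewrite (rootP (fy i)) scale0r addr0 row_diag_mx -scalemxAl -rowE rowV.
  by rewrite !mxE.
by rewrite det_mulmx det_diag mulrC; congr (_ * _); apply: eq_bigr => i _; rewrite mxE.
Qed.

(* Two common roots give a kernel of dimension at least 2, so that all maximal
   minors vanish. *)
Lemma adj_norm_mod_eq0 y1 y2 g : y1 != y2 ->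
  root f y1 -> root f y2 -> root g y1 -> root g y2 ->
  \adj (horner_mx (mulX_mx f) g) = 0.
Proof.
move=> y12 f1 f2 g1 g2; set G := horner_mx _ _.
have kerG y : root f y -> root g y -> pow_row y *m G = 0.
  move=> fy gy; have [w ->] := pow_row_horner_mx f_monic size_f g y.
  by rewrite (rootP fy) (rootP gy) !scale0r addr0.
apply/matrixP => i j; rewrite [LHS]mxE [RHS]mxE /cofactor.
suff /eqP -> : \det (row' j (col' i G)) == 0 by rewrite mulr0.
have n0 : (0 < n)%N.
  case: n f size_f f1 f2 {kerG G} => // f' sf'.
  move=> r1 r2; apply: contraNT y12 => _.
  have := @max_poly_roots _ f' [:: y1; y2].
  by rewrite -size_poly_gt0 sf' /= r1 r2 inE andbT => /(_ isT isT); case: eqP => // _ /(_ isT).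
(* This combination of the two kernel vectors vanishes at [j]; dropping that coordinate gives a
   kernel vector of the minor. *)
pose w := y2 ^+ j *: pow_row y1 - y1 ^+ j *: pow_row y2.
have wG : w *m G = 0 by rewrite mulmxBl -!scalemxAl !kerG // !scaler0 subrr.
have wj : w 0 j = 0 by rewrite !mxE mulrC subrr.
have w0 : w != 0.
  apply: contraNneq y12 => w0.
  have := congr1 (fun v : 'rV_n.+1 => v 0 ord0) w0.
  have := congr1 (fun v : 'rV_n.+1 => v 0 (Ordinal (n0 : 1 < n.+1)%N)) w0.
  rewrite !mxE /= !expr1 !expr0 !mulr1 => E1 /eqP; rewrite subr_eq0 => /eqP E0.
  move/eqP: E1; rewrite E0 -mulrBr mulf_eq0 subr_eq0 => /orP[|//].
  rewrite expf_eq0 => /andP[j0 /eqP y10]; move/eqP: E0; rewrite y10 expr0n gtn_eqF //.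
  by rewrite expf_eq0 j0 /= => /eqP ->.
apply/det0P; exists (col' j w).
  apply: contraNneq w0 => w0; apply/eqP/rowP => l; rewrite [RHS]mxE.
  case: (unliftP j l) => [l' ->|->]; last exact: wj.
  by have := congr1 (fun v : 'rV_n => v 0 l') w0; rewrite mxE [RHS]mxE.
apply/rowP => l; rewrite !mxE.
have := congr1 (fun v : 'rV_n.+1 => v 0 (lift i l)) wG.
rewrite mxE [RHS]mxE (bigD1_ord j) //= wj mul0r add0r => E; rewrite -[RHS]E.
by apply: eq_bigr => m _; rewrite !mxE.
Qed.

End Split.
End Companion.

(** * Divisibility and size of norms over [F[T]] *)

Section PolyNorm.
Variables (F : finFieldType) (n : nat) (f : {poly {poly F}}).
Hypotheses (f_monic : f \is monic) (size_f : size f = n.+2).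
Implicit Types (P : {poly F}) (g : {poly {poly F}}).

Local Notation N := (norm_mod n f).

Lemma dvdp_norm_mod D g x : D %| f.[x] -> D %| g.[x] -> D %| N g.
Proof.
move=> Df Dg; have [a [b ->]] := norm_mod_in_ideal f_monic size_f g x.
by rewrite dvdp_add // dvdp_mulr.
Qed.

(** Writing the adjugate as [P *: H] and [\det G = e * P] gives [G *m H = e%:M]. Hence [\det G]
    divides a power of [e], and [P] divides [e] as well. *)
Lemma dvdp_sqr_det P m (G : 'M[{poly F}]_m.+1) : prime_poly P ->
  (forall i j, P %| (\adj G) i j) -> P ^+ 2 %| \det G.
Proof.
move=> pP adjP; have P0 := prime_poly_neq0 pP.
pose H := map_mx (fun a => a %/ P) (\adj G).
have adjE : \adj G = P *: H.
  by apply/matrixP => i j; rewrite [RHS]mxE [H i j]mxE mulrC divpK.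
have detP : P %| \det G.
  have := congr1 (fun M : 'M[{poly F}]_m.+1 => M ord0 ord0) (mul_mx_adj G).
  rewrite adjE -scalemxAr mxE [RHS]mxE eqxx mulr1n => <-; exact: dvdp_mulr.
have [e detE] := dvdpP _ _ detP.
have GH : G *m H = e%:M.
  apply: (@scalemx_inj _ _ _ P P0).
  by rewrite /= scalemxAr -adjE mul_mx_adj detE scale_scalar_mx mulrC.
have /(prime_poly_dvdX pP) Pe : P %| e ^+ m.+1.
  by rewrite -det_scalar -GH det_mulmx dvdp_mulr.
by rewrite detE expr2 dvdp_mul.
Qed.

(** The constant bounds the entries of the first [n.+1] powers of the matrix; the rest is the
    Leibniz expansion. *)
Lemma size_norm_mod_bound : exists c, forall m g, (size g <= n.+1)%N ->
  (forall i, (size (g`_i)%R <= m)%N) -> (size (N g) <= n.+1 * (m + c))%N.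
Proof.
pose M := mulX_mx n f.
pose c := (\max_(i < n.+1) \max_(a < n.+1) \max_(b < n.+1) size ((M ^+ i) a b))%N.
exists c => m g sg gm; rewrite /norm_mod -/M; set G := horner_mx M g.
have Gab a b : (size (G a b) <= m + c)%N.
  rewrite /G horner_mx_coef summxE.
  apply: leq_trans (size_sum _ _ _) _; apply/bigmax_leqP => i _; rewrite mxE.
  have ci : (size ((M ^+ i) a b) <= c)%N.
    have lti : (i < n.+1)%N := leq_trans (ltn_ord i) sg.
    rewrite -[nat_of_ord i]/(nat_of_ord (Ordinal lti)).
    apply: leq_trans (leq_bigmax (Ordinal lti)).
    by apply: leq_trans (leq_bigmax a); exact: (leq_bigmax b).
  apply: leq_trans (size_polyMleq _ _) _.
  by apply: leq_trans (leq_pred _) _; apply: leq_add.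
apply: leq_trans (size_sum _ _ _) _; apply/bigmax_leqP => s _.
rewrite size_Msign.
apply: leq_trans (size_poly_prod_leq _ _) _.
have -> : #|(fun=> true) : pred 'I_n.+1| = n.+1 by rewrite -[RHS]card_ord.
rewrite subSS; apply: leq_trans (leq_subr _ _) _.
apply: (@leq_trans (\sum_(i < n.+1) (m + c))%N); first exact: leq_sum.
by rewrite sum_nat_const card_ord.
Qed.

End PolyNorm.

(** * Reduction modulo a prime not dividing the discriminant *)

Lemma residue_closure (F : finFieldType) (P : {poly F}) : prime_poly P ->
  exists (L : fieldType) (k : closedFieldType)
    (pi : {rmorphism {poly F} -> L}) (iota : {rmorphism L -> k}),
    (forall a, (pi a == 0) = (P %| a)) /\ (forall z, exists a, pi a = z).
Proof.
move=> pP; have mi : monic_irreducible_poly P.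
  by split; [apply: prime_poly_irr | apply: prime_poly_monic].
have [k [iota _]] := countable_algebraic_closure {poly %/ P with mi}.
exists {poly %/ P with mi}, k, (in_qpoly P), iota; split=> [a|z].
  rewrite -val_eqE /= mk_monicE // /dvdp.
  by rewrite Pdiv.IdomainMonic.modpE ?prime_poly_monic.
exists (val z); apply: val_inj; rewrite /= Pdiv.CommonRing.rmodp_small //.
exact: size_mk_monic.
Qed.

Lemma horner_taylor2 (A : comNzRingType) (p : {poly A}) x h :
  exists c, p.[x + h] = p.[x] + p^`().[x] * h + h ^+ 2 * c.
Proof.
elim/poly_ind: p => [|p a [c IHp]].
  by exists 0; rewrite deriv0 !horner0; ring.
exists (c * (x + h) + p^`().[x]); rewrite derivD derivM derivX derivC mulr1.
by rewrite !hornerE IHp; ring.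
Qed.

Lemma closed_horner_eq0 (k : closedFieldType) (p : {poly k}) :
  (forall x, p.[x] = 0) -> p = 0.
Proof.
move=> p0; have [sp|sp] := leqP (size p) 1.
  by rewrite [p]size1_polyC // -[p`_0](hornerC _ 0) -size1_polyC ?p0.
have : size (p - 1) != 1.
  by rewrite size_polyDl ?gtn_eqF // size_polyN size_poly1.
case/closed_rootP => x; rewrite /root !hornerE p0 sub0r oppr_eq0.
by rewrite (negPf (oner_neq0 _)).
Qed.

Section Reduction.
Variables (F : finFieldType) (n : nat) (f : {poly {poly F}}).
Hypotheses (f_monic : f \is monic) (size_f : size f = n.+2).
Variable delta : {poly F}.
Hypothesis disc : exists u v, delta%:P = u * f + v * f^`().
Variable P : {poly F}.
Hypotheses (pP : prime_poly P) (Pdelta : ~~ (P %| delta)).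
Implicit Types (g h : {poly {poly F}}).

Local Notation N := (norm_mod n f).

Section Closure.
Variables (L : fieldType) (k : closedFieldType).
Variables (pi : {rmorphism {poly F} -> L}) (iota : {rmorphism L -> k}).
Hypotheses (piP : forall a, (pi a == 0) = (P %| a)).
Hypotheses (pi_surj : forall z, exists a, pi a = z).

Variable phi : {rmorphism {poly F} -> k}.
Hypothesis phiE : forall a, phi a = iota (pi a).

Lemma phi_eq0 a : (phi a == 0) = (P %| a).
Proof. by rewrite phiE fmorph_eq0 piP. Qed.

Lemma phi_horner g x : (map_poly phi g).[phi x] = phi g.[x].
Proof. by rewrite horner_map. Qed.

Lemma phi_f_monic : map_poly phi f \is monic.
Proof. exact: monic_map. Qed.

Lemma size_phi_f : size (map_poly phi f) = n.+2.
Proof.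
by rewrite size_map_poly_id0 // (monicP f_monic) rmorph1 oner_neq0.
Qed.

(** The Bezout relation for [delta] survives reduction, where [delta] becomes a nonzero constant, so
    [f] has no repeated root modulo [P]. *)
Lemma split_roots : exists2 y : 'I_n.+1 -> k, injective y &
  map_poly phi f = \prod_i ('X - (y i)%:P).
Proof.
have [r Er] := closed_field_poly_normal (map_poly phi f).
rewrite (monicP phi_f_monic) scale1r in Er.
have sr : size r = n.+1.
  by have := size_phi_f; rewrite Er size_prod_XsubC => -[].
have ur : uniq r.
  rewrite -separable_prod_XsubC -Er unlock; apply/coprimepP => d df df'.
  have [u [v E]] := disc.
  have := congr1 (map_poly phi) E.
  rewrite rmorphD !rmorphM /= -deriv_map map_polyC /= => E'.
  have : d %| (phi delta)%:P by rewrite E' dvdp_add // dvdp_mull.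
  move=> dd; rewrite -size_poly_eq1 eqn_leq.
  have c0 : phi delta != 0 by rewrite phi_eq0.
  have C0 : (phi delta)%:P != 0 :> {poly k} by rewrite polyC_eq0.
  have := dvdp_leq C0 dd; rewrite size_polyC c0 => -> /=.
  rewrite size_poly_gt0; apply: contraNneq C0 => d0.
  by move: dd; rewrite d0 dvd0p.
exists (fun i : 'I_n.+1 => r`_i).
  move=> i j /eqP; rewrite nth_uniq ?sr // => /eqP; exact: val_inj.
by rewrite Er (big_nth 0) big_mkord sr.
Qed.

Variable y : 'I_n.+1 -> k.
Hypotheses (yI : injective y) (fE : map_poly phi f = \prod_i ('X - (y i)%:P)).

Lemma root_y i : root (map_poly phi f) (y i).
Proof. by rewrite fE (bigD1 i) //= rootM root_XsubC eqxx. Qed.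

Lemma phi_norm g : phi (N g) = \prod_i (map_poly phi g).[y i].
Proof.
by rewrite map_norm_mod (norm_mod_split phi_f_monic size_phi_f _ yI root_y).
Qed.

Lemma two_roots_dvd_norm i j g : i != j ->
  root (map_poly phi g) (y i) -> root (map_poly phi g) (y j) -> P ^+ 2 %| N g.
Proof.
move=> ij gi gj; apply: dvdp_sqr_det => // a b.
have yij : y i != y j by rewrite (inj_eq yI).
have := adj_norm_mod_eq0 phi_f_monic size_phi_f yij (root_y i) (root_y j) gi gj.
rewrite -map_mulX_mx -map_horner_mx -map_mx_adj => /matrixP/(_ a b).
by rewrite !mxE => /eqP; rewrite phi_eq0.
Qed.

(** The gcd of [f] and [g] can be computed over the residue field, and over the closure it is
    linear. So it is already linear over the residue field, which then contains its root. *)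
Lemma lone_root_rational i g : root (map_poly phi g) (y i) ->
  (forall j, j != i -> ~~ root (map_poly phi g) (y j)) ->
  exists x, phi x = y i.
Proof.
move=> gi gj; pose h := gcdp (map_poly pi f) (map_poly pi g).
have hE : map_poly iota h = gcdp (map_poly phi f) (map_poly phi g).
  by rewrite gcdp_map -!map_poly_comp !(eq_map_poly phiE).
have hi : map_poly iota h %= 'X - (y i)%:P.
  apply/andP; split; last by rewrite hE dvdp_gcd -!root_factor_theorem root_y.
  have : map_poly iota h %| map_poly phi f by rewrite hE dvdp_gcdl.
  rewrite fE (bigD1 i) //= Gauss_dvdpl //.
  rewrite coprimep_sym; elim/big_ind: _ => [|a b|j ji].
  - by rewrite coprime1p.
  - by rewrite coprimepMl => -> ->.
  by rewrite coprimep_sym coprimep_XsubC hE root_gcd negb_and gj ?orbT.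
have sh : size h = 2%N.
  by rewrite -(size_map_poly iota) (eqp_size hi) size_XsubC.
have h1 : h`_1 != 0 by rewrite -[h`_1]/(h`_(2.-1)) -sh -lead_coefE lead_coef_eq0 -size_poly_gt0 sh.
have [x xE] := pi_surj (- h`_0 / h`_1); exists x.
have : root (map_poly iota h) (y i) by rewrite (eqp_root hi) root_XsubC.
rewrite /root horner_coef size_map_poly sh !big_ord_recl big_ord0 /= !coef_map /=.
rewrite expr0 expr1 mulr1 addr0 addrC addr_eq0 => /eqP E.
apply: (mulfI (_ : iota h`_1 != 0)); first by rewrite fmorph_eq0.
by rewrite E phiE xE -rmorphM /= mulrC divfK // rmorphN.
Qed.

Lemma deriv_root_coprime x : P %| f.[x] -> ~~ (P %| f^`().[x]).
Proof.
move=> fx; apply: contra Pdelta => f'x; have [u [v E]] := disc.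
have := congr1 (fun p => p.[x]) E; rewrite !hornerE => ->.
by rewrite dvdp_add // dvdp_mull.
Qed.

Lemma hensel_lift i x0 : phi x0 = y i ->
  exists2 x, phi x = y i & P ^+ 2 %| f.[x].
Proof.
move=> x0i; have Pf : P %| f.[x0].
  by rewrite -phi_eq0 -phi_horner x0i; apply: root_y.
have [u fu] := dvdpP _ _ Pf; have nf' := deriv_root_coprime Pf.
have [s sE] := pi_surj (- pi u / pi f^`().[x0]).
have Pus : P %| u + f^`().[x0] * s.
  rewrite -piP rmorphD rmorphM /= sE mulrC divfK ?subrr //.
  by rewrite piP.
exists (x0 + P * s).
  have /eqP P0 : phi P == 0 by rewrite phi_eq0.
  by rewrite rmorphD rmorphM x0i P0 mul0r addr0.
have [c ->] := horner_taylor2 f x0 (P * s).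
rewrite dvdp_add //; last by rewrite exprMn -mulrA dvdp_mulr.
rewrite fu mulrCA [u * P]mulrC -mulrDr expr2 dvdp_mul //.
Qed.

(* Shifting [g] by the constant [c = g.[x]] produces a polynomial whose norm is
   divisible by [P ^+ 2]; as the characteristic polynomial has a simple root
   modulo [P], the norm of [g] is then divisible by [P ^+ 2] only if [c] is. *)
Lemma lone_root_dvd_norm i g x : root (map_poly phi g) (y i) ->
  (forall j, j != i -> ~~ root (map_poly phi g) (y j)) ->
  phi x = y i -> P ^+ 2 %| f.[x] -> P ^+ 2 %| N g -> P ^+ 2 %| g.[x].
Proof.
move=> gi gj xi fx Ng; set c := g.[x].
have phic : phi c = 0 by rewrite -phi_horner xi; apply/eqP.
have [c1 cE] : exists c1, c = c1 * P by apply/dvdpP; rewrite -phi_eq0 phic.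
pose g0 := g - c%:P; pose chi := char_poly (- horner_mx (mulX_mx n f) g0).
have Ng0 : P ^+ 2 %| chi.[0].
  rewrite -norm_mod_shift addr0; apply: (dvdp_norm_mod f_monic size_f fx).
  by rewrite !hornerE subrr dvdp0.
have NgE : N g = chi.[0 + c] by rewrite add0r -norm_mod_shift subrK.
have map_g0 : map_poly phi g0 = map_poly phi g.
  by rewrite rmorphB /= map_polyC /= phic subr0.
have chiE : map_poly phi chi = 'X * \prod_(j | j != i) ('X + ((map_poly phi g).[y j])%:P).
  apply/eqP; rewrite -subr_eq0; apply/eqP/closed_horner_eq0 => z.
  rewrite hornerD hornerN hornerM hornerX horner_prod.
  have -> : (map_poly phi chi).[z] = \prod_j ((map_poly phi g).[y j] + z).
    rewrite /chi map_char_poly map_mxN map_horner_mx map_mulX_mx.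
    rewrite -norm_mod_shift (norm_mod_split phi_f_monic size_phi_f _ yI root_y).
    by apply: eq_bigr => j _; rewrite map_g0 !hornerE.
  rewrite (bigD1 i) //= (rootP gi) add0r; apply/eqP; rewrite subr_eq0; apply/eqP.
  by congr (_ * _); apply: eq_bigr => j _; rewrite !hornerE addrC.
have chi0 : ~~ (P %| chi^`().[0]).
  rewrite -phi_eq0 -phi_horner rmorph0 -deriv_map chiE derivM derivX mul1r.
  rewrite hornerD hornerM hornerX mul0r addr0 horner_prod.
  by apply/prodf_neq0 => j ji; rewrite !hornerE; exact: gj.
have [e chic] := horner_taylor2 chi 0 c.
have : P ^+ 2 %| chi^`().[0] * c.
  have -> : chi^`().[0] * c = N g - chi.[0] - c ^+ 2 * e by rewrite NgE chic; ring.
  by rewrite !dvdp_sub // cE exprMn -mulrA mulrCA dvdp_mulr.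
rewrite [in X in X -> _]cE cE mulrA expr2 !dvdp_mul2r ?(prime_poly_neq0 pP) //.
by rewrite (prime_poly_dvdM _ _ pP) (negPf chi0).
Qed.

End Closure.

(** Modulo [P] the norm is the product of the values of [g] at the roots of [f], so some root is
    common. A second common root would make [P ^+ 2] divide the norm; hence the root is alone and
    rational. *)
Lemma simple_prime_root g : P %| N g -> ~~ (P ^+ 2 %| N g) ->
  exists x : {poly F}, [/\ (size x <= degp P)%N, P %| f.[x] & P %| g.[x]].
Proof.
have [L [k [pi [iota [piP pis]]]]] := residue_closure pP.
pose phi : {rmorphism {poly F} -> k} := iota \o pi.
have phiE a : phi a = iota (pi a) by [].
have [y yI fE] := split_roots piP phiE => Ng Ng2.
have : phi (N g) == 0 by rewrite (phi_eq0 piP phiE).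
rewrite (phi_norm yI fE) => /prodf_eq0[i _ gi].
have [|x0 x0i] := lone_root_rational pis phiE fE gi.
  move=> j ji; apply: contra Ng2 => gj.
  exact: (two_roots_dvd_norm piP phiE yI fE ji).
exists (x0 %% P).
have xi : phi (x0 %% P) = y i.
  rewrite -x0i; apply/eqP; rewrite -subr_eq0 -rmorphB (phi_eq0 piP phiE).
  by rewrite [X in _ - X](divp_eq x0 P) opprD addrCA subrr addr0 -mulNr dvdp_mull.
split.
- by rewrite -ltnS -prime_poly_size // ltn_modp prime_poly_neq0.
- rewrite -(phi_eq0 piP phiE) -phi_horner xi; exact: (root_y fE).
- by rewrite -(phi_eq0 piP phiE) -phi_horner xi.
Qed.

(** For distinct [i] and [j], the subgroup consists of the [g] vanishing at both roots modulo [P].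
    On the diagonal, the root must be rational and [g] must vanish modulo [P ^+ 2] at its lifts that
    are roots of [f] modulo [P ^+ 2]; asking that such a lift exists is what forces [P ^+ 2] to
    divide the norm. *)
Lemma sqr_norm_cover : exists W : 'I_n.+1 -> 'I_n.+1 -> {poly {poly F}} -> Prop,
  [/\ forall i j g h, W i j g -> W i j h -> W i j (g - h),
      forall i j g, W i j g -> P ^+ 2 %| N g &
      forall g, P ^+ 2 %| N g -> exists i j, W i j g].
Proof.
have [L [k [pi [iota [piP pis]]]]] := residue_closure pP.
pose phi : {rmorphism {poly F} -> k} := iota \o pi.
have phiE a : phi a = iota (pi a) by [].
have [y yI fE] := split_roots piP phiE.
exists (fun i j g => if i != j
  then is_true (root (map_poly phi g) (y i) && root (map_poly phi g) (y j))
  else (exists2 x, phi x = y i & P ^+ 2 %| f.[x]) /\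
    forall x, phi x = y i -> P ^+ 2 %| f.[x] -> P ^+ 2 %| g.[x]).
split=> [i j g h|i j g|g Ng].
- case: (i != j) => [/andP[gi gj] /andP[hi hj]|[ex gx] [_ hx]]; last first.
    by split=> // x xi fx; rewrite !hornerE dvdp_sub ?gx ?hx.
  by rewrite rmorphB /= /root !hornerE !(rootP _) // subrr eqxx.
- case: (i =P j) => [_ [[x xi fx] /(_ x xi fx)]|/eqP ij /andP[gi gj]].
    exact: dvdp_norm_mod.
  exact: (two_roots_dvd_norm piP phiE yI fE ij gi gj).
have : phi (N g) == 0.
  by rewrite (phi_eq0 piP phiE); apply: dvdp_trans Ng; rewrite dvdp_exp.
rewrite (phi_norm yI fE) => /prodf_eq0[i _ gi].
have [/existsP[j /andP[ji gj]]|] :=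
  boolP [exists j, (j != i) && root (map_poly phi g) (y j)].
  by exists j, i; rewrite ji gj /root gi.
rewrite negb_exists => /forallP nj; exists i, i; rewrite eqxx /=.
have gj j : j != i -> ~~ root (map_poly phi g) (y j).
  by move=> ji; have := nj j; rewrite ji.
have [x0 x0i] := lone_root_rational pis phiE fE gi gj.
split; first exact: (hensel_lift piP pis phiE fE x0i).
by move=> x xi fx; apply: (lone_root_dvd_norm piP phiE yI fE gi gj xi fx Ng).
Qed.

End Reduction.

(** * Packing bounds for values of monic polynomials *)

Section Separated.

(* Read [Sm k a] as "[a] has size at most [k]" for some absolute value of [A]
   in which [z] is large unless [near z]. *)
Lemma monic_separated (A : idomainType) (Sm : nat -> A -> Prop)
    (near : pred A) (j : nat) :
  (forall k a b, Sm k a -> Sm k b -> Sm k (a - b)) ->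
  (forall k a z, ~~ near z -> Sm (k + j)%N (z * a) -> Sm k a) ->
  ~ Sm 0%N 1 ->
  forall d (chi : {poly A}) (s : seq A), chi \is monic -> size chi = d.+1 ->
  pairwise (fun x y => ~~ near (y - x)) s ->
  {in s, forall x, Sm (d * j)%N chi.[x]} -> (size s <= d)%N.
Proof.
move=> SmB SmM Sm1; elim=> [|d IHd] chi [|x s] //= chim sz.
  move=> _ /(_ x (mem_head _ _)); rewrite mul0n.
  have -> : chi = 1.
    move/monicP: chim; rewrite lead_coefE sz /= => E.
    by rewrite [chi]size1_polyC ?sz // E.
  by rewrite hornerC.
move=> /andP[/allP sepx seps] Smx.
have /factor_theorem[chi1 E] : root (chi - chi.[x]%:P) x.
  by rewrite /root !hornerE subrr.
have chiE : chi = chi1 * ('X - x%:P) + chi.[x]%:P by rewrite -E subrK.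
have chi10 : chi1 != 0.
  apply/eqP => c0; move: chiE; rewrite c0 mul0r add0r => c0'.
  by have := sz; rewrite c0' size_polyC; case: (_ != 0).
have sz' : size (chi1 * ('X - x%:P)) = (size chi1).+1.
  by rewrite size_Mmonic ?monicXsubC // size_XsubC addn2.
have sC : (size (chi.[x]%:P) < size (chi1 * ('X - x%:P))%R)%N.
  rewrite sz' size_polyC; case: (_ != 0) => //=.
  by rewrite ltnS size_poly_gt0.
have sz1 : size chi1 = d.+1.
  by apply/eqP; rewrite -eqSS -sz' -(size_polyDl sC) -chiE sz.
have chi1m : chi1 \is monic.
  move: chim; rewrite {1}chiE monicE lead_coefDl // lead_coefM lead_coefXsubC mulr1.
  by rewrite -monicE.
rewrite ltnS; apply: (IHd chi1) => // z zs.
apply: (SmM _ _ (z - x)); first exact: sepx.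
have -> : (z - x) * chi1.[z] = chi.[z] - chi.[x].
  by rewrite {1}chiE !hornerE mulrC addrK.
by rewrite addnC -mulSn; apply: SmB; apply: Smx; rewrite inE ?zs ?orbT ?eqxx.
Qed.

(** Greedy packing: remove from [X] the neighbourhood of one of its points. What remains has no
    separated sequence longer than [d - 1], since that point could be prepended to it. *)
Lemma card_separated (Z : finZmodType) (near : pred Z) d (X : {set Z}) :
  near 0 ->
  (forall s : seq Z, {subset s <= X} ->
     pairwise (fun x y => ~~ near (y - x)) s -> (size s <= d)%N) ->
  (#|X| <= d * #|[set z | near z]|)%N.
Proof.
move=> near0; elim: d X => [|d IHd] X sepX.
  rewrite mul0n leqn0 cards_eq0; apply/eqP/setP => x; rewrite !inE.
  apply/negP => xX; suff : (size [:: x] <= 0)%N by [].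
  by apply: sepX => // y; rewrite inE => /eqP ->.
have [->|[x xX]] := set_0Vmem X; first by rewrite cards0.
pose Y := [set y | near (y - x)].
have cY : #|Y| = #|[set z | near z]|.
  rewrite -(card_preimset _ (@addIr _ (- x))).
  by apply: eq_card => y; rewrite !inE.
rewrite -(cardsID Y X) mulSn leq_add //.
  by rewrite -cY subset_leq_card // subsetIr.
apply: IHd => s sX seps; have := sepX (x :: s); rewrite /= seps andbT ltnS; apply.
  by move=> y; rewrite inE => /orP[/eqP -> //|/sX]; rewrite inE => /andP[].
by apply/allP => y /sX; rewrite !inE => /andP[].
Qed.

End Separated.

(** * Counting in boxes of polynomials with bounded coefficients *)

Section Box.
Variables (F : finFieldType) (n : nat).
Implicit Types (g h : {poly {poly F}}) (m k : nat).
Local Notation q := #|F|.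

Definition in_box m g : Prop :=
  (size g <= n.+1)%N /\ forall i, (size (g`_i)%R <= m)%N.

Definition box m := {ffun 'I_n.+1 -> {poly_m F}}.

Definition boxp m (B : box m) : {poly {poly F}} :=
  \poly_(i < n.+1) val (B (inord i)).

Definition tobox m g : box m := [ffun i : 'I_n.+1 => npolyp m g`_i].

Definition box_count m (S : {poly {poly F}} -> Prop) : nat :=
  #|[set B : box m | `[< S (boxp B) >]]|.

Lemma coef_boxp m (B : box m) (i : 'I_n.+1) : (boxp B)`_i = val (B i).
Proof. by rewrite coef_poly ltn_ord inord_val. Qed.

Lemma boxp_in_box m (B : box m) : in_box m (boxp B).
Proof.
split=> [|i]; first exact: size_poly.
by rewrite coef_poly; case: ifP => _; [apply: size_npoly | rewrite size_poly0].
Qed.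

Lemma boxp_inj m : injective (@boxp m).
Proof.
by move=> B C E; apply/ffunP => i; apply: val_inj; rewrite -!coef_boxp E.
Qed.

Lemma boxpK m g : in_box m g -> boxp (tobox m g) = g.
Proof.
move=> [sg gm]; apply/polyP => i; rewrite coef_poly.
case: ltnP => [lt|le]; last by rewrite nth_default // (leq_trans sg).
by rewrite ffunE inordK //= npolypK.
Qed.

Lemma boxpD m (B C : box m) : boxp (B + C) = boxp B + boxp C.
Proof.
apply/polyP => i; rewrite coefD !coef_poly; case: ifP => _; rewrite ?addr0 //.
by rewrite ffunE.
Qed.

Lemma in_boxD m g h : in_box m g -> in_box m h -> in_box m (g + h).
Proof.
move=> [sg gm] [sh hm]; split=> [|i].
  by rewrite (leq_trans (size_polyD _ _)) // geq_max sg.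
by rewrite coefD (leq_trans (size_polyD _ _)) // geq_max gm hm.
Qed.

Lemma in_boxN m g : in_box m g -> in_box m (- g).
Proof. by move=> [sg gm]; split=> [|i]; rewrite ?coefN size_polyN. Qed.

Lemma in_boxB m g h : in_box m g -> in_box m h -> in_box m (g - h).
Proof. by move=> gm /in_boxN; apply: in_boxD. Qed.

Lemma in_boxW m k g : (m <= k)%N -> in_box m g -> in_box k g.
Proof. by move=> mk [sg gm]; split=> // i; apply: leq_trans mk. Qed.

Lemma in_boxC m (a : {poly F}) : (size a <= m)%N -> in_box m a%:P.
Proof.
move=> am; split=> [|i].
  by rewrite (leq_trans (size_polyC_leq1 _)).
by rewrite coefC; case: eqP => _; rewrite ?size_poly0.
Qed.

Lemma card_box m : #|{: box m}| = (q ^ (n.+1 * m))%N.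
Proof. by rewrite card_ffun card_npoly card_ord -expnM mulnC. Qed.

(** The translates of the points of [S] by the elements of the small box stay in the large one and
    are all distinct, because a coincidence would give a nonzero element of [S] in the small box. *)
Lemma box_count_lattice (S : {poly {poly F}} -> Prop) k m :
  (forall g h, S g -> S h -> S (g - h)) ->
  (forall g, in_box k g -> S g -> g = 0) -> (k <= m)%N ->
  (q ^ (n.+1 * k) * box_count m S <= q ^ (n.+1 * m))%N.
Proof.
move=> SB S0 km; rewrite -!card_box -[X in (X * _)%N]cardsT -cardsX.
pose h (p : box k * box m) := tobox m (boxp p.1 + boxp p.2).
have hE p : boxp (h p) = boxp p.1 + boxp p.2.
  apply: boxpK; apply: in_boxD; last exact: boxp_in_box.
  by apply: in_boxW km _; apply: boxp_in_box.
rewrite -(@card_in_imset _ _ h) ?max_card // => -[C B] [C' B'].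
rewrite !inE /= => SB1 SB2 E.
have := congr1 (@boxp m) E; rewrite !hE /= => {}E.
have E' : boxp C - boxp C' = boxp B' - boxp B.
  by apply/eqP; rewrite subr_eq addrAC eq_sym subr_eq addrC -E addrC.
have CC : boxp C - boxp C' = 0.
  apply: S0; first by apply: in_boxB; apply: boxp_in_box.
  by rewrite E'; apply: SB.
move: CC; rewrite E' => /subr0_eq/boxp_inj BB.
by move: E'; rewrite BB subrr => /subr0_eq/boxp_inj ->.
Qed.

(** Adding a constant of size at most [m] permutes the box, so the count can be averaged over such
    shifts. *)
Lemma box_count_shift (S : {poly {poly F}} -> Prop) m K :
  (forall g, #|[set z : {poly_m F} | `[< S (g + (val z)%:P)%R >]]| <= K)%N ->
  (q ^ m * box_count m S <= q ^ (n.+1 * m) * K)%N.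
Proof.
move=> hK.
have -> : (q ^ m * box_count m S = \sum_(z : {poly_m F}) \sum_(B : box m)
    (`[< S (boxp B + (val z)%:P)%R >] : nat))%N.
  rewrite (eq_bigr (fun=> box_count m S)); first by rewrite sum_nat_const card_npoly.
  move=> z _; rewrite /box_count -sum1_card [RHS]big_mkcond /=.
  rewrite [RHS](reindex_inj (@addIr _ (tobox m (val z)%:P))) /=; apply: eq_bigr => B _.
  rewrite finset.in_set boxpD boxpK; last exact/in_boxC/size_npoly.
  by case: `[< _ >].
rewrite exchange_big /= -card_box -sum_nat_const; apply: leq_sum => B _.
apply: leq_trans (hK (boxp B)); rewrite -sum1_card [X in (_ <= X)%N]big_mkcond /=.
by apply: leq_sum => z _; rewrite finset.in_set; case: `[< _ >].
Qed.

Lemma card_npoly_dvd (D : {poly F}) m : D != 0 -> (degp D <= m)%N ->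
  (#|[set z : {poly_m F} | (D %| val z)%R]| <= q ^ (m - degp D))%N.
Proof.
move=> D0 Dm; rewrite -card_npoly.
pose h (z : {poly_m F}) := npolyp (m - degp D) (val z %/ D).
have hE (z : {poly_m F}) : D %| val z -> (val (h z) : {poly F}) * D = val z.
  move=> Dz; rewrite /= npolypK ?divpK // size_divp // leq_sub2r //.
  exact: size_npoly.
rewrite -(@card_in_imset _ _ h) ?max_card // => z1 z2; rewrite !inE => D1 D2 E.
by apply: val_inj; rewrite -(hE _ D1) -(hE _ D2) E.
Qed.

Lemma card_npoly_size j m : (j <= m)%N ->
  (#|[set z : {poly_m F} | (size (val z) <= j)%N]| <= q ^ j)%N.
Proof.
move=> jm; rewrite -card_npoly.
pose h (z : {poly_m F}) := npolyp j (val z).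
rewrite -(@card_in_imset _ _ h) ?max_card // => z1 z2; rewrite !inE => D1 D2 E.
by apply: val_inj; rewrite -(npolypK D1) -(npolypK D2) -/(h _) E.
Qed.

(** On each line of shifts, [Nm] takes the values of a monic polynomial, and shifts giving small
    values cannot contain more than [n.+1] separated points. It serves for the [P]-adic absolute
    value and for the degree. *)
Lemma box_count_monic (Nm : {poly {poly F}} -> {poly F})
    (chi : {poly {poly F}} -> {poly {poly F}}) (Sm : nat -> {poly F} -> Prop)
    (near : pred {poly F}) j m :
  (forall g, chi g \is monic) -> (forall g, size (chi g) = n.+2) ->
  (forall g z, Nm (g + z%:P) = (chi g).[z]) ->
  (forall k a b, Sm k a -> Sm k b -> Sm k (a - b)) ->
  (forall k a z, ~~ near z -> Sm (k + j)%N (z * a) -> Sm k a) ->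
  ~ Sm 0%N 1 -> near 0 ->
  (q ^ m * box_count m (fun g => Sm (n.+1 * j)%N (Nm g)) <=
   q ^ (n.+1 * m) * (n.+1 * #|[set z : {poly_m F} | near (val z)]|))%N.
Proof.
move=> chim chis chiE SmB SmM Sm1 near0; apply: box_count_shift => g.
apply: (@card_separated _ (fun z : {poly_m F} => near (val z))) => // s sX seps.
rewrite -(size_map val); apply: (monic_separated SmB SmM Sm1 (chim g) (chis g)).
  by rewrite pairwise_map.
move=> _ /mapP[z /sX + ->]; rewrite inE => /asboolP.
by rewrite chiE.
Qed.

End Box.

(** * Evaluation at a point modulo [P]: growth of images and equidistribution *)

Section Evaluation.
Variables (F : finFieldType) (n : nat) (P x0 : {poly F}).
Hypothesis pP : prime_poly P.
Implicit Types (g h : {poly {poly F}}) (m k : nat).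
Local Notation q := #|F|.
Local Notation r := (degp P).
Local Notation in_box := (in_box n).

Definition eval_mod g : {poly_r F} := npolyp r (g.[x0] %% P).

Definition eval_image k : {set {poly_r F}} :=
  [set eval_mod (boxp B) | B : box F n k].

Lemma val_eval_mod g : val (eval_mod g) = g.[x0] %% P.
Proof.
by rewrite /= npolypK // -ltnS -prime_poly_size // ltn_modp prime_poly_neq0.
Qed.

Lemma eval_modD g h : eval_mod (g + h) = eval_mod g + eval_mod h.
Proof. by apply: val_inj; rewrite [RHS]raddfD /= -!/(val _) !val_eval_mod hornerD modpD. Qed.

Lemma eval_modB g h : eval_mod (g - h) = eval_mod g - eval_mod h.
Proof. by apply/eqP; rewrite eq_sym subr_eq -eval_modD subrK. Qed.

Lemma eval_mod_eq0 g : (eval_mod g == 0) = (P %| g.[x0]).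
Proof. by rewrite -val_eqE val_eval_mod. Qed.

Lemma eval_mod_mull a g h :
  eval_mod g = eval_mod h -> eval_mod (a%:P * g) = eval_mod (a%:P * h).
Proof.
move=> E; apply/eqP; rewrite -subr_eq0 -eval_modB eval_mod_eq0 -mulrBr hornerM.
by rewrite dvdp_mull // -eval_mod_eq0 eval_modB E subrr.
Qed.

Lemma mem_eval_image k y :
  y \in eval_image k <-> exists2 g, in_box k g & eval_mod g = y.
Proof.
split=> [/imsetP[B _ ->]|[g gk <-]]; first by exists (boxp B); first exact: boxp_in_box.
by apply/imsetP; exists (tobox n k g); rewrite ?boxpK.
Qed.

Lemma eval_imageD k y z :
  y \in eval_image k -> z \in eval_image k -> y + z \in eval_image k.
Proof.
move=> /mem_eval_image[g gk <-] /mem_eval_image[h hk <-].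
by apply/mem_eval_image; exists (g + h); rewrite ?eval_modD //; apply: in_boxD.
Qed.

Lemma eval_imageB k y z :
  y \in eval_image k -> z \in eval_image k -> y - z \in eval_image k.
Proof.
move=> /mem_eval_image[g gk <-] /mem_eval_image[h hk <-].
by apply/mem_eval_image; exists (g - h); rewrite ?eval_modB //; apply: in_boxB.
Qed.

Lemma eval_imageS k l : (k <= l)%N -> eval_image k \subset eval_image l.
Proof.
move=> kl; apply/fintype.subsetP => y /mem_eval_image[g gk <-].
by apply/mem_eval_image; exists g => //; apply: in_boxW gk.
Qed.

Lemma eval_image_full : eval_image r = [set: {poly_r F}].
Proof.
apply/setP => y; rewrite finset.inE; apply/mem_eval_image; exists (val y)%:P.
  exact/in_boxC/size_npoly.
apply: val_inj; rewrite val_eval_mod hornerC modp_small //.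
by rewrite (prime_poly_size pP) ltnS size_npoly.
Qed.

Lemma in_box_mulXn k l g : in_box k g -> in_box (l + k) (('X^l)%:P * g).
Proof.
move=> [sg gk]; split=> [|i]; rewrite mul_polyC.
  by apply: leq_trans sg; apply: size_scale_leq.
rewrite coefZ (leq_trans (size_polyMleq _ _)) // size_polyXn addSn /=.
by rewrite leq_add2l.
Qed.

Lemma in_box_split k g : in_box k.+1 g -> exists g1 g2,
  [/\ in_box k g1, in_box 1 g2 & g = g1 + ('X^k)%:P * g2].
Proof.
move=> [sg gk].
exists (\poly_(i < n.+1) take_poly k g`_i), (\poly_(i < n.+1) drop_poly k g`_i).
split.
- split=> [|i]; first exact: size_poly.
  by rewrite coef_poly; case: ifP => _; rewrite ?size_poly0 // size_take_poly.
- split=> [|i]; first exact: size_poly.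
  rewrite coef_poly; case: ifP => _; rewrite ?size_poly0 // size_drop_poly.
  by rewrite leq_subLR addn1.
apply/polyP => i; rewrite coefD mul_polyC coefZ !coef_poly.
case: ltnP => [_|le]; first by rewrite [_ * drop_poly _ _]mulrC poly_take_drop.
by rewrite mulr0 addr0 nth_default // (leq_trans sg).
Qed.

(** Multiplication by [T] sends the image at level [k] into level [k.+1], so a step without growth
    makes the image stable under multiplication by [T]. *)
Lemma eval_image_stable k l : eval_image k.+1 \subset eval_image k ->
  (k <= l)%N -> eval_image l \subset eval_image k.
Proof.
move=> /fintype.subsetP stab.
have top j g : in_box 1 g -> eval_mod (('X^(k + j))%:P * g) \in eval_image k.
  move=> g1; elim: j => [|j IHj].
    apply: stab; apply/mem_eval_image; exists (('X^(k + 0))%:P * g) => //.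
    by rewrite addn0 -addn1; apply: in_box_mulXn.
  have /mem_eval_image[h hk E] := IHj; apply: stab; apply/mem_eval_image.
  exists (('X^1)%:P * h); first exact: in_box_mulXn.
  by rewrite (eval_mod_mull _ E) mulrA -polyCM -exprD add1n addnS.
elim: l => [|l IHl].
  by rewrite leqn0 => /eqP ->; apply/fintype.subsetP.
rewrite leq_eqVlt => /orP[/eqP <- //|].
rewrite ltnS => kl; have /fintype.subsetP sub := IHl kl.
apply/fintype.subsetP => y /mem_eval_image[g /in_box_split[g1 [g2 [b1 b2 ->]]] <-].
rewrite eval_modD eval_imageD //; last by rewrite -(subnKC kl); apply: top.
by apply: sub; apply/mem_eval_image; exists g1.
Qed.

(** The images are increasing groups: if one step does not enlarge the image, it is full by
    stability; otherwise a proper subgroup inclusion at least doubles the cardinality. *)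
Lemma eval_image_grow k t : eval_image (k + t) = [set: {poly_r F}] \/
  (2 ^ t * #|eval_image k| <= #|eval_image (k + t)|)%N.
Proof.
elim: t => [|t [IHt|IHt]]; first by right; rewrite addn0 mul1n.
  by left; apply/eqP; rewrite -finset.subTset -IHt eval_imageS // leq_add2l.
have [stab|/fintype.subsetPn[z z1 z0]] :=
  boolP (eval_image (k + t).+1 \subset eval_image (k + t)).
  left; apply/eqP; rewrite -finset.subTset.
  apply: (@fintype.subset_trans _ _ (mem (eval_image (k + t)))); last first.
    by rewrite eval_imageS // leq_add2l.
  rewrite -eval_image_full; have [le|lt] := leqP r (k + t); first exact: eval_imageS.
  exact: (eval_image_stable stab (ltnW lt)).
right; rewrite expnS -mulnA addnS.
apply: (@leq_trans (2 * #|eval_image (k + t)|)); first by rewrite leq_mul2l.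
rewrite mul2n -addnn; set I := eval_image (k + t).
(* The coset of [z] is disjoint from [I] and lies in the next image. *)
have cz : #|[set z + y | y in I]| = #|I| by apply/card_imset/addrI.
rewrite -{2}cz -cardsUI.
have -> : #|I :&: [set z + y | y in I]| = 0%N.
  apply: eq_card0 => y; rewrite !finset.inE; apply/negP => /andP[yI /imsetP[w wI E]].
  by case/negP: z0; rewrite -[z](addrK w) -E; apply: eval_imageB.
rewrite addn0 subset_leq_card //; apply/fintype.subsetP => y.
rewrite finset.inE => /orP[|/imsetP[w wI ->]].
  exact/fintype.subsetP/eval_imageS.
apply: eval_imageD => //; move: wI; exact/fintype.subsetP/eval_imageS.
Qed.

(** Evaluation is injective on the box of level [k], and [t] further levels fill the residue field.
    Being additive and onto at level [m], it has equally large fibres there, so no constant factor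
    is lost. *)
Lemma box_count_root k t m :
  (forall g, in_box k g -> P %| g.[x0] -> g = 0) ->
  (q ^ r <= q ^ (n.+1 * k) * 2 ^ t)%N -> (k + t <= m)%N ->
  (box_count n m (fun g => (P %| g.[x0])%R) * q ^ r <= q ^ (n.+1 * m))%N.
Proof.
move=> ker0 bound ktm.
have cardI : #|eval_image k| = (q ^ (n.+1 * k))%N.
  rewrite card_imset ?card_box // => B C E; apply: boxp_inj; apply: subr0_eq.
  apply: ker0; first by apply: in_boxB; apply: boxp_in_box.
  by rewrite -eval_mod_eq0 eval_modB E subrr.
have fullkt : eval_image (k + t) = [set: {poly_r F}].
  case: (eval_image_grow k t) => // le; apply/eqP.
  rewrite eqEcard finset.subsetT /= cardsT card_npoly (leq_trans bound) //.
  by rewrite -cardI mulnC.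
have full y : y \in eval_image m.
  have : y \in [set: {poly_r F}] by rewrite finset.inE.
  rewrite -fullkt; exact/fintype.subsetP/eval_imageS.
have ex y : exists B : box F n m, eval_mod (boxp B) == y.
  by have /imsetP[B _ ->] := full y; exists B.
pose h (p : box F n m * {poly_r F}) := p.1 + xchoose (ex p.2).
have hE p : P %| (boxp p.1).[x0] -> eval_mod (boxp (h p)) = p.2.
  by rewrite -eval_mod_eq0 boxpD eval_modD => /eqP ->; rewrite add0r (eqP (xchooseP (ex _))).
rewrite -card_box -card_npoly -[X in (_ * X)%N]cardsT -cardsX.
rewrite -(@card_in_imset _ _ h) ?max_card // => -[B y] [C z].
rewrite !finset.inE !andbT /= => /asboolP RB /asboolP RC E.
have yz : y = z by have := hE (B, y) RB; rewrite E (hE (C, z) RC).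
by move: E; rewrite yz /h /= => /addIr ->.
Qed.

End Evaluation.

(** * Frequency of exceptional norms and of prescribed roots in a box *)

Section BoxNorm.
Variables (F : finFieldType) (n : nat) (f : {poly {poly F}}).
Hypotheses (f_monic : f \is monic) (size_f : size f = n.+2).
Variable delta : {poly F}.
Hypothesis disc : exists u v, delta%:P = u * f + v * f^`().
Local Notation N := (norm_mod n f).
Hypothesis N_neq0 : forall g : {poly {poly F}}, g != 0 -> (size g <= n.+1)%N -> N g != 0.
Variable c : nat.
Hypothesis size_N : forall m (g : {poly {poly F}}), (size g <= n.+1)%N ->
  (forall i, (size (g`_i)%R <= m)%N) -> (size (N g) <= n.+1 * (m + c))%N.
Implicit Types (P D : {poly F}) (g h : {poly {poly F}}) (m k : nat).
Local Notation q := #|F|.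
Local Notation d := n.+1.

Let q_gt0 : (0 < q)%N. Proof. exact: ltnW (card_finNzRing_gt1 F). Qed.

Lemma box_count_bigcup (I : finType) m (S : {poly {poly F}} -> Prop)
    (W : I -> {poly {poly F}} -> Prop) :
  (forall g, in_box n m g -> S g -> exists i, W i g) ->
  (box_count n m S <= \sum_i box_count n m (W i))%N.
Proof.
move=> SW; pose U := \bigcup_i [set B : box F n m | `[< W i (boxp B) >]].
apply: (@leq_trans #|U|); last first.
  apply: (big_ind2 (fun (A : {set box F n m}) k => #|A| <= k)%N) => //.
    by rewrite cards0.
  by move=> A a B b Aa Bb; rewrite (leq_trans (leq_card_setU _ _)) // leq_add.
apply: subset_leq_card; apply/fintype.subsetP => B.
rewrite finset.in_set => /asboolP SB; have [i Wi] := SW _ (boxp_in_box B) SB.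
by apply/finset.bigcupP; exists i => //; rewrite finset.in_set; apply/asboolP.
Qed.

Lemma prime_pow_cancel P k j a z : prime_poly P -> ~~ (P ^+ j.+1 %| z) ->
  P ^+ (k + j).+1 %| z * a -> P ^+ k.+1 %| a.
Proof.
move=> pP nz; have z0 : z != 0 by apply: contraNneq nz => ->; rewrite dvdp0.
have [e [b [zE nb]]] := prime_poly_valuation pP z0.
have ej : (e <= j)%N.
  by rewrite leqNgt; apply: contra nz => lt; rewrite zE dvdp_mull // dvdp_exp2l.
have P0 := prime_poly_neq0 pP.
rewrite zE -(subnKC ej) addnCA -addnS exprD [b * _]mulrC -mulrA.
rewrite dvdp_mul2l ?expf_neq0 // Gauss_dvdpr; last first.
  by rewrite coprimep_expl // irreducible_poly_coprime //; apply: prime_poly_irr.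
by apply: dvdp_trans; rewrite dvdp_exp2l // ltnS leq_addr.
Qed.

Let chi g := char_poly (- horner_mx (mulX_mx n f) g).
Let chi_monic g : chi g \is monic. Proof. exact: char_poly_monic. Qed.
Let size_chi g : size (chi g) = n.+2. Proof. exact: size_char_poly. Qed.
Let chiE g z : N (g + z%:P) = (chi g).[z]. Proof. exact: norm_mod_shift. Qed.

(** The [P]-adic case of [box_count_monic]: shifts are near each other when congruent modulo
    [P ^+ j.+1]. *)
Lemma box_count_prime_pow P j m : prime_poly P -> (j.+1 * degp P <= m)%N ->
  (box_count n m (fun g => (P ^+ (d * j).+1 %| N g)%R) * q ^ (j.+1 * degp P)
    <= d * q ^ (d * m))%N.
Proof.
move=> pP jm; pose near z := P ^+ j.+1 %| z.
have P0 := prime_poly_neq0 pP.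
have := @box_count_monic F n N chi (fun k a => P ^+ k.+1 %| a) near j m
  chi_monic size_chi chiE.
have eP : degp (P ^+ j.+1) = (j.+1 * degp P)%N by rewrite degpX mulnC.
have := @card_npoly_dvd F (P ^+ j.+1) m; rewrite eP expf_neq0 // => /(_ isT jm) cn.
move=> /(_ _ _ _ _) H.
have {H} : (q ^ m * box_count n m (fun g => (P ^+ (d * j).+1 %| N g)%R)
   <= q ^ (d * m) * (d * q ^ (m - j.+1 * degp P)))%N.
  apply: leq_trans (H _ _ _ _) _.
  - by move=> k a b; apply: dvdp_sub.
  - by move=> k a z; apply: prime_pow_cancel.
  - by rewrite expr1; apply/negP/prime_poly_ndvd1.
  - exact: dvdp0.
  by rewrite leq_mul2l leq_mul2l cn orbT orbT.
rewrite -{1}(subnKC jm) expnD.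
rewrite [X in (_ <= X)%N](_ : _ = q ^ (m - j.+1 * degp P) * (d * q ^ (d * m)))%N; last by lia.
rewrite mulnAC [X in (X <= _)%N]mulnC leq_pmul2l ?expn_gt0 ?q_gt0 //.
by rewrite mulnC.
Qed.

(** The case of the degree: shifts are near each other when their difference has size at most
    [m - s]. *)
Lemma box_count_small_norm s m : (s <= m)%N ->
  (box_count n m (fun g => (size (N g) <= d * (m - s))%N) * q ^ s
    <= d * q ^ (d * m))%N.
Proof.
move=> sm; pose near (z : {poly F}) := (size z <= m - s)%N.
have := @box_count_monic F n N chi (fun k a => (size a <= k)%N) near (m - s) m
  chi_monic size_chi chiE.
have cn := @card_npoly_size F (m - s) m (leq_subr _ _).
move=> H.
have {H} : (q ^ m * box_count n m (fun g => (size (N g) <= d * (m - s))%N)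
   <= q ^ (d * m) * (d * q ^ (m - s)))%N.
  apply: leq_trans (H _ _ _ _) _.
  - by move=> k a b sa sb; rewrite (leq_trans (size_polyD _ _)) // size_polyN geq_max sa.
  - move=> k a z; rewrite /near -ltnNge => sz.
    have [->|a0] := eqVneq a 0; first by rewrite size_poly0.
    have z0 : z != 0 by rewrite -size_poly_gt0 (leq_trans _ sz).
    rewrite size_mul //; move: sz; case: (size z) => // w; rewrite ltnS addSn /= => sz; rewrite addnC => H1.
    by rewrite -(leq_add2r (m - s)) (leq_trans _ H1) // leq_add2l.
  - by rewrite size_poly1.
  - by rewrite /near size_poly0.
  by rewrite leq_mul2l leq_mul2l cn orbT orbT.
rewrite -{1}(subnK sm) expnD.
rewrite [X in (_ <= X)%N](_ : _ = q ^ (m - s) * (d * q ^ (d * m)))%N; last by lia.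
by rewrite -mulnA leq_pmul2l ?expn_gt0 ?q_gt0 // mulnC.
Qed.

Lemma in_box0 g : in_box n 0 g -> g = 0.
Proof.
move=> [_ g0]; apply/polyP => i; rewrite coef0; apply/eqP.
by rewrite -size_poly_leq0.
Qed.

(** In a box of level at most [cutoff (degp D)], norms of nonzero elements are too small to be
    divisible by [D]. *)
Let cutoff r := (r %/ d - c)%N.

Lemma cutoff_le r : (r <= d * cutoff r + d * c.+1)%N.
Proof. by rewrite /cutoff; have := divn_eq r d; have := ltn_pmod r (ltn0Sn n); nia. Qed.

Lemma lattice_trivial (S : {poly {poly F}} -> Prop) D k :
  D != 0 -> (forall g, S g -> D %| N g) -> (k <= cutoff (degp D))%N ->
  forall g, in_box n k g -> S g -> g = 0.
Proof.
move=> D0 SD kD g gk Sg; apply/eqP/negPn/negP => g0.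
(* Level 0 is treated apart: only for positive [k] does the truncated subtraction in [cutoff] give
   [k + c <= degp D %/ d]. *)
have k0 : (0 < k)%N.
  by case: k gk {kD} => // /in_box0 E; rewrite E eqxx in g0.
have [sg gi] := gk; have Ng0 := N_neq0 g0 sg.
have kc : (k + c <= degp D %/ d)%N by move: kD k0; rewrite /cutoff; lia.
have : (size D <= degp D)%N.
  rewrite (leq_trans (dvdp_leq Ng0 (SD g Sg))) // (leq_trans (size_N sg gi)) //.
  by rewrite mulnC (leq_trans _ (leq_trunc_div (degp D) d)) // leq_mul2r kc orbT.
by rewrite /degp -ltnS prednK ?size_poly_gt0 // ltnn.
Qed.

(** A group of elements whose norms are divisible by [D] meets a box of level about [degp D / d]
    trivially; the lattice bound then gives the expected density up to a constant. *)
Lemma box_count_dvd (S : {poly {poly F}} -> Prop) D m :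
  D != 0 -> (forall g h, S g -> S h -> S (g - h)) ->
  (forall g, S g -> D %| N g) -> (degp D <= d * (m + c))%N ->
  (box_count n m S * q ^ degp D <= q ^ (d * m + d * c.+1))%N.
Proof.
move=> D0 SB SD Dm; pose k := minn m (cutoff (degp D)).
have := @box_count_lattice F n S k m SB (lattice_trivial D0 SD (geq_minr _ _)) (geq_minl _ _).
have rk : (degp D <= d * k + d * c.+1)%N.
  by rewrite /k; case: (leqP m (cutoff (degp D))) => _; [nia | exact: cutoff_le].
move=> H; rewrite expnD; apply: leq_trans (leq_mul H (leqnn _)).
rewrite [X in (_ <= X)%N]mulnAC -expnD mulnC leq_mul2r.
by rewrite leq_pexp2l ?orbT.
Qed.

(** If [P ^+ 2] has larger degree than any norm from the box, only zero could contribute. Otherwise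
    [sqr_norm_cover] and the lattice bound apply to each of [d ^ 2] groups. *)
Lemma box_count_sqr P m : prime_poly P -> ~~ (P %| delta) ->
  (box_count n m (fun g => g != 0%R /\ (P ^+ 2 %| N g)%R) * q ^ (degp P * 2)
    <= d ^ 2 * q ^ (d * m + d * c.+1))%N.
Proof.
move=> pP Pd; have P20 : P ^+ 2 != 0 by rewrite expf_neq0 // prime_poly_neq0.
have [le|lt] := leqP (degp (P ^+ 2)) (d * (m + c)); last first.
  rewrite (_ : box_count _ _ _ = 0%N) //; apply: eq_card0 => B.
  rewrite finset.in_set; apply/negP => /asboolP[g0 PN].
  have [sg gi] := boxp_in_box B; have Ng0 := N_neq0 g0 sg.
  have := degp_dvd Ng0 PN; rewrite leqNgt => /negP; apply.
  apply: leq_ltn_trans lt; apply: leq_trans (size_N sg gi).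
  exact: leq_pred.
have [W [WB WN Wc]] := sqr_norm_cover f_monic size_f disc pP Pd.
rewrite -degpX.
apply: (@leq_trans (\sum_(p : 'I_d * 'I_d) box_count n m (W p.1 p.2) * q ^ degp (P ^+ 2))).
  rewrite -big_distrl /= leq_mul2r; apply/orP; right.
  apply: (box_count_bigcup (W := fun p : 'I_d * 'I_d => W p.1 p.2)).
  by move=> g _ [_ /Wc[i [j Wij]]]; exists (i, j).
apply: (@leq_trans (\sum_(p : 'I_d * 'I_d) q ^ (d * m + d * c.+1))).
  by apply: leq_sum => p _; apply: box_count_dvd => //; [apply: WB | apply: WN].
by rewrite sum_nat_const card_prod card_ord.
Qed.

(** Enough doublings to fill the gap left by [cutoff_le]: [2 ^ thr] is at least [q ^ (d * c.+1)],
    because [q <= 2 ^ q]. *)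
Let thr := (q * (d * c.+1))%N.

Lemma box_count_eval P x m : prime_poly P -> P %| f.[x] ->
  (thr <= m)%N -> (degp P <= d * (m - thr))%N ->
  (box_count n m (fun g => (P %| g.[x])%R) * q ^ degp P <= q ^ (d * m))%N.
Proof.
move=> pP fx tm Pm; apply: (@box_count_root F n P x pP (cutoff (degp P)) thr).
- move=> g gk gx; apply: (@lattice_trivial (fun g => P %| g.[x]) P _ _ _ _ g gk gx) => //.
    exact: prime_poly_neq0.
  by move=> h hx; apply: (dvdp_norm_mod f_monic size_f fx).
- apply: (@leq_trans (q ^ (d * cutoff (degp P) + d * c.+1))).
    by rewrite leq_pexp2l // cutoff_le.
  rewrite expnD leq_mul2l; apply/orP; right.
  by rewrite /thr [X in (_ <= X)%N]expnM leq_exp2r // ltnW // ltn_expl.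
rewrite -(subnK tm) leq_add2r /cutoff; apply: leq_trans (leq_subr _ _) _.
by rewrite -(mulKn (m - thr) (ltn0Sn n)) leq_div2r.
Qed.

(** This loses a constant factor against [box_count_eval], but reaches the last few degrees, whose
    total weight is bounded. *)
Lemma box_count_eval_top P x m : prime_poly P -> P %| f.[x] ->
  (degp P <= d * (m + c))%N ->
  (box_count n m (fun g => (P %| g.[x])%R) * q ^ degp P
    <= q ^ (d * m + d * c.+1))%N.
Proof.
move=> pP fx Pm; apply: box_count_dvd => //.
- exact: prime_poly_neq0.
- by move=> g h gx hx; rewrite !hornerE dvdp_sub.
- by move=> g gx; apply: (dvdp_norm_mod f_monic size_f fx).
Qed.

End BoxNorm.

(** * Sums over primes and bounds on root counts *)

Section PrimeSums.
Variables (F : finFieldType) (R : realFieldType).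
Implicit Types (P : {poly F}).
Local Notation Q := (#|F|%:R : R).

Lemma natr_card_ge2 : 2 <= Q.
Proof. by rewrite (ler_nat R 2); apply: card_finNzRing_gt1. Qed.

Lemma natr_card_gt0 : 0 < Q.
Proof. by apply: lt_le_trans natr_card_ge2. Qed.

Lemma big_primes_upto_le (T : Type) (idx : T) (op : Monoid.com_law idx)
    (G : {poly F} -> T) (C : pred {poly F}) M n : (M <= n)%N ->
  \big[op/idx]_(P <- primes_upto F n | C P && (degp P <= M)%N) G P =
  \big[op/idx]_(P <- primes_upto F M | C P) G P.
Proof.
move=> Mn; under eq_bigl do rewrite andbC; rewrite -big_filter_cond.
apply: perm_big; apply: uniq_perm.
- exact/filter_uniq/primes_upto_uniq.
- exact: primes_upto_uniq.
move=> P; rewrite mem_filter !mem_primes_upto; case: (prime_poly P) => //=.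
  by case: (leqP (degp P) M) => // le; rewrite (leq_trans le Mn).
by rewrite andbF.
Qed.

(** Primes are grouped by degree and counted with [card_primes_of_deg]. *)
Lemma sum_primes_le a n (w : nat -> R) : (forall r, 0 <= w r) ->
  \sum_(P <- primes_upto F n | (a < degp P)%N) w (degp P) <=
  \sum_(a.+1 <= r < n.+1) w r * Q ^+ r / r%:R.
Proof.
move=> w0; elim: n => [|n IHn].
  rewrite big1_seq ?big_geq // => P /andP[aP]; rewrite mem_primes_upto leqn0 => /andP[_ /eqP P0].
  by rewrite P0 in aP.
rewrite (bigID (fun P => (degp P <= n)%N)) /= big_primes_upto_le //.
have [an|na] := leqP n.+1 a.
  rewrite big_geq // !big1_seq ?addr0 // => P /andP[+ +]; rewrite mem_primes_upto.
    by move=> /andP[aP _] /andP[_ /leq_trans/(_ an)]; rewrite leqNgt aP.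
  by move=> aP /andP[_ /leq_trans/(_ (ltnW an))]; rewrite leqNgt aP.
rewrite big_nat_recr //= lerD //.
rewrite (@big_seq_cond R) (eq_bigr (fun=> w n.+1)); last first.
  move=> P /andP[]; rewrite mem_primes_upto => /andP[_ le] /andP[_].
  by rewrite -ltnNge => lt; congr w; apply/eqP; rewrite eqn_leq le.
have -> : \sum_(i <- primes_upto F n.+1 | [&& i \in primes_upto F n.+1,
    (a < degp i)%N & ~~ (degp i <= n)%N]) w n.+1 =
    w n.+1 *+ count (fun P => degp P == n.+1) (primes_upto F n.+1).
  rewrite big_const_seq iter_addr_0; congr (_ *+ _); apply: eq_in_count => P Ps.
  rewrite Ps /=; move: Ps; rewrite mem_primes_upto => /andP[_ le].
  rewrite -ltnNge eqn_leq le /=; case: (ltnP n (degp P)) => [lt|]; rewrite ?andbF //.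
  by rewrite andbT (leq_trans na lt).
rewrite -[X in X <= _]mulr_natr -[X in _ <= X]mulrA ler_wpM2l // ler_pdivlMr ?ltr0n // -natrM -natrX ler_nat.
by rewrite mulnC card_primes_of_deg.
Qed.

Lemma sum_primes_deg_le a n : (a <= n)%N ->
  \sum_(P <- primes_upto F n | (a < degp P)%N) (degp P)%:R / Q ^+ degp P <=
  (n - a)%:R :> R.
Proof.
move=> an; have w0 r : 0 <= r%:R / Q ^+ r by rewrite divr_ge0 // exprn_ge0.
apply: le_trans (@sum_primes_le a n (fun r => r%:R / Q ^+ r) w0) _.
rewrite big_nat (eq_bigr (fun=> 1)).
  by rewrite -big_nat sumr_const_nat subSS.
move=> r /andP[ar _]; rewrite mulfVK ?divff ?pnatr_eq0 ?gtn_eqF ?(leq_trans _ ar) //.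
by rewrite expf_neq0 // gt_eqF // natr_card_gt0.
Qed.

Lemma sum_primes_sqr_le a n :
  \sum_(P <- primes_upto F n | (a < degp P)%N) (Q ^+ (degp P * 2))^-1 <=
  (Q ^+ a)^-1 :> R.
Proof.
have Q0 := natr_card_gt0; have QX0 r : 0 < Q ^+ r by rewrite exprn_gt0.
have w0 r : 0 <= (Q ^+ (r * 2))^-1 by rewrite invr_ge0 ltW.
apply: le_trans (@sum_primes_le a n (fun r => (Q ^+ (r * 2))^-1) w0) _.
have [an|na] := leqP a n; last by rewrite big_geq ?ltnS ?(ltnW na) // invr_ge0 ltW.
(* The sharper telescoping bound is the one that passes through the induction on [n]. *)
apply: (@le_trans _ _ ((Q ^+ a)^-1 - (Q ^+ n)^-1)); last first.
  by rewrite lerBlDr lerDl invr_ge0 ltW.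
elim: n an => [|n IHn]; first by rewrite leqn0 => /eqP ->; rewrite big_geq ?subrr.
rewrite leq_eqVlt => /orP[/eqP <-|an]; first by rewrite big_geq ?subrr.
rewrite big_nat_recr //= (le_trans (lerD (IHn an) (lexx _))) //.
set y := (Q ^+ n.+1)^-1; have y0 : 0 < y by rewrite invr_gt0.
have -> : (Q ^+ n)^-1 = Q * y by rewrite /y exprS invfM mulVKf // gt_eqF.
have -> : (Q ^+ (n.+1 * 2))^-1 * Q ^+ n.+1 = y.
  by rewrite /y exprM expr2 invfM mulfVK // gt_eqF.
have : y / n.+1%:R <= y by rewrite ler_pdivrMr ?ltr0n // ler_peMr ?ler1n // ltW.
have : 2 * y <= Q * y by rewrite ler_pM2r // natr_card_ge2.
move: (y / n.+1%:R) (Q * y) ((Q ^+ a)^-1) => t u v; lra.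
Qed.

End PrimeSums.

(** Residues modulo [P] are represented by the polynomials of degree less than [degp P]. *)
Definition root_count (F : finFieldType) (f : {poly {poly F}}) (P : {poly F}) :=
  #|[set x : {poly_(degp P) F} | P %| f.[val x]]|.

Lemma root_count_le (F : finFieldType) n (f : {poly {poly F}}) P :
  f \is monic -> size f = n.+2 -> prime_poly P -> (root_count f P <= n.+1)%N.
Proof.
move=> fm sf pP; pose near (z : {poly_(degp P) F}) := P %| val z.
have := @card_npoly_dvd F P (degp P) (prime_poly_neq0 pP) (leqnn _).
rewrite subnn expn0 => near1.
apply: (@leq_trans (n.+1 * #|[set z | near z]|)); last first.
  by rewrite -[X in (_ <= X)%N]muln1 leq_mul2l near1 orbT.
apply: (card_separated (dvdp0 P)) => s sX seps.
rewrite -(size_map val).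
apply: (@monic_separated _ (fun k a => P ^+ k.+1 %| a) (fun z => P %| z) 0 _ _ _ _ _ _ fm sf).
- by move=> k a b; apply: dvdp_sub.
- move=> k a z nz; rewrite addn0 Gauss_dvdpr // coprimep_expl //.
  by rewrite irreducible_poly_coprime //; apply: prime_poly_irr.
- by apply/negP/prime_poly_ndvd1.
- by rewrite pairwise_map.
move=> _ /mapP[z /sX + ->]; rewrite finset.in_set muln0 expr1; exact.
Qed.

(** * The explicit Mertens-type inequality for monic separable [f] *)

Section Mertens.
Variables (F : finFieldType) (n : nat) (f : {poly {poly F}}).
Hypotheses (f_monic : f \is monic) (size_f : size f = n.+2).
Variable delta : {poly F}.
Hypothesis delta_neq0 : delta != 0.
Hypothesis disc : exists u v, delta%:P = u * f + v * f^`().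
Local Notation N := (norm_mod n f).
Hypothesis N_neq0 : forall g : {poly {poly F}},
  g != 0 -> (size g <= n.+1)%N -> N g != 0.
Variable c : nat.
Hypothesis size_N : forall m (g : {poly {poly F}}), (size g <= n.+1)%N ->
  (forall i, (size (g`_i)%R <= m)%N) -> (size (N g) <= n.+1 * (m + c))%N.
Implicit Types (P D : {poly F}) (g h : {poly {poly F}}) (m k : nat).
Local Notation q := #|F|.
Local Notation d := n.+1.

Section Pointwise.
Variables (a j s m : nat).
Hypothesis delta_a : (degp delta <= a)%N.
Let nn := (d * (m + c))%N.
Let C2 := (\sum_(P <- primes_upto F a) d * j * degp P)%N.

Lemma large_prime_ndvd_delta P : (a < degp P)%N -> ~~ (P %| delta).
Proof.
move=> aP; apply/negP => /(degp_dvd delta_neq0); rewrite leqNgt => /negP; apply.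
exact: leq_ltn_trans aP.
Qed.

(** Primes of degree at most [a] count as small. If [bad1] fails at the small primes, [bad2] at the
    large ones, and [bad3] too, the norm has degree at least [d * (m - s)] and is a product of
    distinct large primes up to a factor of degree at most [C2]. *)
Let bad1 g P := P ^+ (d * j).+1 %| N g.
Let bad2 g P := (g != 0) && (P ^+ 2 %| N g).
Let bad3 g := (size (N g) <= d * (m - s))%N.

(** When an exceptional event occurs, the last term alone suffices. Otherwise each large prime
    dividing the norm divides it once and is seen through a common root of [f] and [g]. *)
Lemma degree_le_simple_primes g : in_box n m g ->
  (d * (m - s) <= C2
   + \sum_(P <- primes_upto F nn | (a < degp P)%N)
       \sum_(x : {poly_(degp P) F} | (P %| f.[val x])%R) degp P * (P %| g.[val x])%R
   + d * (m - s) * (\sum_(P <- primes_upto F a) bad1 g P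
       + \sum_(P <- primes_upto F nn | (a < degp P)%N) bad2 g P + bad3 g))%N.
Proof.
move=> gm; set bads := (X in (_ + d * (m - s) * X)%N).
have [b0|bpos] := posnP bads; last first.
  by apply: leq_trans (leq_addl _ _); rewrite -[X in (X <= _)%N]muln1 leq_mul2l bpos orbT.
rewrite b0 muln0 addn0; move/eqP: b0.
rewrite !addn_eq0 !sum_nat_seq_eq0 => /andP[/andP[/allP no1 /allP no2] no3].
have big : (d * (m - s) < size (N g))%N.
  by move: no3; rewrite eqb0 -ltnNge.
have Ng0 : N g != 0 by rewrite -size_poly_gt0 (leq_ltn_trans _ big).
have g0 : g != 0.
  by apply: contraNneq Ng0 => ->; rewrite /norm_mod rmorph0 det0.
have [sg gi] := gm.
have dN : (degp (N g) <= nn)%N by rewrite (leq_trans (leq_pred _)) // size_N.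
have no1' P : prime_poly P -> (degp P <= a)%N -> ~~ bad1 g P.
  move=> pP Pa; have := no1 P; rewrite mem_primes_upto pP Pa => /(_ isT) /=.
  by rewrite eqb0.
have no2' P : prime_poly P -> (a < degp P)%N -> ~~ (P ^+ 2 %| N g).
  move=> pP aP; apply/negP => P2.
  have Pnn : (degp P <= nn)%N.
    apply: leq_trans dN; apply: degp_dvd => //; apply: dvdp_trans P2.
    by rewrite dvdp_exp.
  by have := no2 P; rewrite mem_primes_upto pP Pnn aP /bad2 g0 P2 => /(_ isT).
pose v P := if (degp P <= a)%N then (d * j)%N else 1%N.
have hv P : prime_poly P -> ~~ (P ^+ (v P).+1 %| N g).
  by rewrite /v => pP; case: leqP => ?; [apply: no1' | apply: no2'].
apply: (@leq_trans (degp (N g))).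
  by rewrite -ltnS /degp prednK // size_poly_gt0.
apply: leq_trans (degp_le_prime_valuations Ng0 dN hv) _.
rewrite (bigID (fun P => (degp P <= a)%N)) /= leq_add //.
  apply: (@leq_trans (\sum_(P <- primes_upto F nn | (degp P <= a)%N) d * j * degp P)%N).
    rewrite [X in (_ <= X)%N](bigID (fun P => (P %| N g)%R)) /=.
    apply: leq_trans (leq_addr _ _).
    under [X in (_ <= X)%N]eq_bigl do rewrite andbC.
    by apply: leq_sum => P /andP[_ Pa]; rewrite /v Pa.
  have [ann|nna] := leqP a nn.
    by rewrite /C2 -(big_primes_upto_le _ _ predT ann).
  apply: (@leq_trans (\sum_(P <- primes_upto F nn) d * j * degp P)%N).
    by rewrite big_mkcond; apply: leq_sum => P _; case: ifP.
  rewrite -[X in (X <= _)%N](big_primes_upto_le _ _ predT (ltnW nna)) /C2.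
  by rewrite big_mkcond; apply: leq_sum => P _; case: ifP.
under eq_bigl do rewrite andbC -ltnNge.
rewrite big_mkcondr /= [X in (X <= _)%N]big_seq_cond [X in (_ <= X)%N]big_seq_cond.
apply: leq_sum => P /andP[]; rewrite mem_primes_upto => /andP[pP _] aP.
case: ifP => // PN; have -> : v P = 1%N by rewrite /v leqNgt aP.
rewrite mul1n.
have [x [sx fx gx]] := simple_prime_root f_monic size_f disc pP (large_prime_ndvd_delta aP) PN (no2' P pP aP).
by rewrite (bigD1 (NPoly sx)) //= gx muln1 leq_addr.
Qed.

Lemma box_countE (S : {poly {poly F}} -> Prop) :
  box_count n m S = (\sum_(B : box F n m) (`[< S (boxp B) >] : nat))%N.
Proof.
rewrite /box_count -sum1_card [LHS]big_mkcond; apply: eq_bigr => B _.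
by rewrite finset.in_set; case: `[< _ >].
Qed.

Lemma box_degree_le :
  (q ^ (d * m) * (d * (m - s)) <= q ^ (d * m) * C2
   + \sum_(P <- primes_upto F nn | (a < degp P)%N)
       \sum_(x : {poly_(degp P) F} | (P %| f.[val x])%R)
         degp P * box_count n m (fun g => (P %| g.[val x])%R)
   + d * (m - s) * (\sum_(P <- primes_upto F a) box_count n m (bad1^~ P)
       + \sum_(P <- primes_upto F nn | (a < degp P)%N)
           box_count n m (fun g => g != 0%R /\ (P ^+ 2 %| N g)%R)
       + box_count n m bad3))%N.
Proof.
rewrite -[X in (X * (d * (m - s)))%N](card_box F n m) -sum_nat_const.
apply: leq_trans (leq_sum _ (fun B _ => degree_le_simple_primes (boxp_in_box B))) _.
rewrite !big_split /= sum_nat_const card_box -big_distrr /= !big_split /=.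
rewrite box_countE exchange_big [X in (_ * (X + _ + _))%N]exchange_big.
rewrite [X in (_ * (_ + X + _))%N]exchange_big /=.
rewrite leq_add ?leq_add2l //.
  apply: leq_sum => P _; rewrite exchange_big /=; apply: leq_sum => x _.
  by rewrite -big_distrr /= box_countE; under [X in (_ <= _ * X)%N]eq_bigr do rewrite asboolb.
rewrite leq_mul2l; apply/orP; right; rewrite !leq_add //.
- by apply: leq_sum => P _; rewrite box_countE; apply: leq_sum => B _; rewrite asboolb.
- apply: leq_sum => P _; rewrite box_countE; apply: leq_sum => B _.
  by case: (boolP (bad2 _ _)) => // /andP H; rewrite asboolT.
- by apply: leq_sum => B _; rewrite asboolb.
Qed.

End Pointwise.

Section Real.
Variable R : realFieldType.
Local Notation Q := (q%:R : R).

Definition root_weight (P : {poly F}) : R :=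
  (root_count f P)%:R * (degp P)%:R / Q ^+ degp P.

Lemma root_weight_ge0 P : 0 <= root_weight P.
Proof. by rewrite /root_weight divr_ge0 ?mulr_ge0 ?exprn_ge0. Qed.

Lemma box_ratio k r e : (k * q ^ r <= e)%N -> k%:R <= e%:R / Q ^+ r :> R.
Proof.
by move=> H; rewrite ler_pdivlMr ?exprn_gt0 ?(natr_card_gt0 F R) // -natrX -natrM ler_nat.
Qed.

(** This is [box_degree_le] divided by the size of the box. The density of exceptional [g] is
    controlled by [a], [j] and [s] alone, uniformly in [m]. *)
Lemma mertens_explicit a j s m (thr := (q * (d * c.+1))%N)
    (K := Q ^+ (d * c.+1)) :
  (degp delta <= a)%N -> (thr <= m)%N -> (s <= m)%N -> (j.+1 * a <= m)%N ->
  (d * (m - s))%:R *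
    (1 - ((size (primes_upto F a))%:R * (d%:R / Q ^+ j.+1)
          + (d ^ 2)%:R * K / Q ^+ a + d%:R / Q ^+ s)) <=
  (\sum_(P <- primes_upto F a) d * j * degp P)%:R
  + \sum_(P <- primes_upto F (d * (m - thr)) | (a < degp P)%N) root_weight P
  + K * d%:R * (d * (c + thr))%:R.
Proof.
move=> da tm sm ja; set C2 := (\sum_(P <- _) _)%N.
have Q0 := natr_card_gt0 F R; have QX0 r : 0 < Q ^+ r by rewrite exprn_gt0.
have K0 : 0 < K by apply: QX0.
pose X := Q ^+ (d * m); have X0 : 0 < X by apply: QX0.
have XE : X = (q ^ (d * m))%:R by rewrite natrX.
pose nn := (d * (m + c))%N; pose M := (d * (m - thr))%N.
have Mnn : (M <= nn)%N by rewrite leq_mul2l (leq_trans (leq_subr _ _)) ?leq_addr ?orbT.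
have := box_degree_le j s m da; rewrite -/C2 -/nn.
set T1 := (\sum_(P <- _ | _) \sum_(x | _) _)%N.
set T2 := (\sum_(P <- primes_upto F a) _)%N.
set T3 := (\sum_(P <- primes_upto F nn | _) _)%N.
set T4 := box_count _ _ _ => main.
have hT2 : T2%:R <= X * ((size (primes_upto F a))%:R * (d%:R / Q ^+ j.+1)).
  rewrite /T2 natr_sum big_seq_cond.
  apply: (@le_trans _ _ (\sum_(P <- primes_upto F a | (P \in primes_upto F a) && true) X * (d%:R / Q ^+ j.+1))).
    apply: ler_sum => P /andP[]; rewrite mem_primes_upto => /andP[pP Pa] _.
    have jP : (j.+1 * degp P <= m)%N by rewrite (leq_trans _ ja) // leq_mul2l Pa orbT.
    have := box_count_prime_pow f_monic size_f pP jP => /box_ratio/le_trans; apply.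
    rewrite natrM -XE mulrAC mulrC ler_pM2l // ler_pM2l ?ltr0n // lef_pV2 ?posrE //.
    apply: ler_weXn2l; first by have := natr_card_ge2 F R; lra.
    by rewrite -{1}[j.+1]muln1 leq_mul2l prime_poly_deg_gt0 ?orbT.
  rewrite -big_seq_cond big_const_seq count_predT iter_addr_0 -[X in X <= _]mulr_natl.
  by rewrite mulrCA lexx.
have hT3 : T3%:R <= X * ((d ^ 2)%:R * K / Q ^+ a).
  rewrite /T3 natr_sum big_seq_cond.
  apply: (@le_trans _ _ (\sum_(P <- primes_upto F nn | (a < degp P)%N)
       X * ((d ^ 2)%:R * K) * (Q ^+ (degp P * 2))^-1)).
    rewrite [X in _ <= X]big_seq_cond.
    apply: ler_sum => P /andP[]; rewrite mem_primes_upto => /andP[pP _] aP.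
    have := box_count_sqr f_monic size_f disc N_neq0 size_N m pP
      (large_prime_ndvd_delta da aP) => /box_ratio/le_trans; apply.
    by rewrite natrM expnD natrM -XE [(q ^ (d * c.+1))%:R]natrX mulrCA lexx.
  rewrite -mulr_sumr -!mulrA ler_pM2l // ler_pM2l ?ltr0n ?expn_gt0 // ler_pM2l //.
  exact: sum_primes_sqr_le.
have hT4 : T4%:R <= X * (d%:R / Q ^+ s).
  have := box_count_small_norm f_monic size_f sm => /box_ratio/le_trans; apply.
  by rewrite natrM -XE mulrCA mulrA.
have hT1 : T1%:R <= X * (\sum_(P <- primes_upto F M | (a < degp P)%N) root_weight P
    + K * d%:R * (d * (c + thr))%:R).
  (* Up to degree [M] roots have the exact expected density; beyond it a factor [K] is lost. *)
  pose w P := X * (if (degp P <= M)%N then root_weight P else K * root_weight P).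
  apply: (@le_trans _ _ (\sum_(P <- primes_upto F nn | (a < degp P)%N) w P)).
    rewrite /T1 natr_sum big_seq_cond [X in _ <= X]big_seq_cond.
    apply: ler_sum => P /andP[]; rewrite mem_primes_upto => /andP[pP Pnn] aP.
    rewrite natr_sum (eq_bigl (fun x : {poly_(degp P) F} =>
      x \in [set x : {poly_(degp P) F} | P %| f.[val x]])); last first.
      by move=> x; rewrite finset.in_set.
    pose e := X * (if (degp P <= M)%N then 1 else K) / Q ^+ degp P.
    apply: (@le_trans _ _ (\sum_(x in [set x : {poly_(degp P) F} | P %| f.[val x]])
        (degp P)%:R * e)).
      apply: ler_sum => x; rewrite finset.in_set => fx; rewrite natrM ler_wpM2l //.
      rewrite /e; case: leqP => PM.
        rewrite mulr1 XE; apply: box_ratio.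
        exact: (box_count_eval f_monic size_f N_neq0 size_N).
      rewrite /K XE -natrX -natrM -expnD; apply: box_ratio.
      exact: (box_count_eval_top f_monic size_f N_neq0 size_N).
    rewrite sumr_const -mulr_natl /w /root_weight /root_count /e.
    set rho := #|_|; case: leqP => _; rewrite le_eqVlt; apply/orP; left; apply/eqP; ring.
  rewrite (bigID (fun P => (degp P <= M)%N)) /= mulrDr lerD //.
    rewrite (eq_bigr (fun P => X * root_weight P)); last by move=> P /andP[_ PM]; rewrite /w PM.
    by rewrite big_primes_upto_le // mulr_sumr.
  (* With at most [d] roots per prime, the range from [M] to [nn] contributes a constant, since
     [nn - M = d * (c + thr)]. *)
  apply: (@le_trans _ _ (\sum_(P <- primes_upto F nn | (M < degp P)%N)
      X * (K * d%:R) * ((degp P)%:R / Q ^+ degp P))).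
    under eq_bigl do rewrite -ltnNge.
    rewrite [X in X <= _]big_mkcond [X in _ <= X]big_mkcond.
    rewrite [X in X <= _]big_seq [X in _ <= X]big_seq /=.
    apply: ler_sum => P; rewrite mem_primes_upto => /andP[pP _].
    case: (ltnP M (degp P)) => [MP|]; last by rewrite andbF.
    rewrite andbT; case: ifP => _; last first.
      by rewrite mulr_ge0 ?divr_ge0 ?mulr_ge0 // ltW.
    rewrite /w leqNgt MP /= -!mulrA ler_pM2l // ler_pM2l // /root_weight -mulrA.
    by rewrite ler_wpM2r ?ler_nat ?(root_count_le f_monic size_f) // divr_ge0 // ltW.
  rewrite -mulr_sumr -!mulrA ler_pM2l // ler_pM2l // ler_pM2l ?ltr0n //.
  apply: le_trans (sum_primes_deg_le _ _ Mnn) _; rewrite ler_nat /nn /M -mulnBr.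
  by rewrite leq_mul2l; apply/orP; right; lia.
set D := (d * (m - s))%:R; have D0 : 0 <= D by [].
have {}main : X * D <= X * C2%:R + T1%:R + D * (T2%:R + T3%:R + T4%:R).
  by move: main; rewrite -(ler_nat R) XE /D -!natrD -!natrM -!natrD.
have := ler_wpM2l D0 (lerD (lerD hT2 hT3) hT4).
move: hT1; set S := \sum_(P <- _ | _) _; set C3 := K * d%:R * _.
set e2 := _ * (d%:R / _); set e3 := _ / Q ^+ a; set e4 := d%:R / Q ^+ s => hT1 hT.
rewrite -(ler_pM2l X0); nra.
Qed.

End Real.
End Mertens.

(** * Irreducibility over the fraction field, and reduction to the monic separable case *)

Section GenericIrreducible.
Variable F : finFieldType.
Implicit Types (f g h : {poly {poly F}}) (a c P : {poly F}).

(* Irreducibility over the fraction field of [{poly F}]. *)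
Definition frac_irreducible f := forall c g h,
  c != 0 -> c *: f = g * h -> (size g <= 1)%N \/ (size h <= 1)%N.

(** Gauss's lemma: modulo [P] the product of [g] and [h] vanishes over a field, so one factor
    does. *)
Lemma prime_content P g h c f : prime_poly P -> c *: f = g * h -> P %| c ->
  (exists g', g = P *: g') \/ (exists h', h = P *: h').
Proof.
move=> pP E Pc; have [L [_ [pi [_ [piP _]]]]] := residue_closure pP.
have content k : map_poly pi k = 0 -> exists k', k = P *: k'.
  move=> k0; exists (\poly_(i < size k) (k`_i %/ P)); apply/polyP => i.
  rewrite coefZ coef_poly; case: ltnP => [_|le]; last by rewrite mulr0 nth_default.
  rewrite mulrC divpK // -piP; have := congr1 (fun p : {poly L} => p`_i) k0.
  by rewrite coef_map coef0 => ->.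
have : map_poly pi g * map_poly pi h = 0.
  rewrite -rmorphM -E /=; apply/polyP => i; rewrite coef_map coefZ coef0 /=.
  by apply/eqP; rewrite piP dvdp_mulr.
by move/eqP; rewrite mulf_eq0 => /orP[/eqP/content|/eqP/content]; [left|right].
Qed.

(** Primes are stripped from [c] one at a time, each being moved out of [g] or [h], until [c] is a
    constant and irreducibility of [f] itself applies. *)
Lemma irreducible_elt_frac f : irreducible_elt f -> frac_irreducible f.
Proof.
move=> [f0 _ irrf] c; have [b] := ubnP (size c); elim: b c => // b IHb c sc g h c0 E.
have [c1|c1] := leqP (size c) 1.
  have cE : c = (c`_0)%:P by apply: size1_polyC.
  have c00 : c`_0 != 0 by rewrite -polyC_eq0 -cE.
  have E1 : f = ((c`_0)^-1%:P *: g) * h.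
    rewrite -scalerAl -E scalerA {2}cE -polyCM mulVf // scale1r //.
  case: (irrf _ _ E1); rewrite poly_unitE => /andP[/eqP s1 _]; [left|right].
    by move: s1; rewrite size_scale ?polyC_eq0 ?invr_eq0 // => ->.
  by rewrite s1.
have [P pP Pc] := ex_prime_poly_dvd c1; have P0 := prime_poly_neq0 pP.
have [c' cE] := dvdpP _ _ Pc.
have c'0 : c' != 0 by apply: contraNneq c0 => z; rewrite cE z mul0r.
have sc' : (size c' < b)%N.
  rewrite -ltnS (leq_trans _ sc) // ltnS cE size_mul // (prime_poly_size pP) addnS /=.
  by rewrite -[X in (X < _)%N]addn0 ltn_add2l prime_poly_deg_gt0.
have cancelP k1 k2 : P *: k1 = P *: k2 -> k1 = k2 :> {poly {poly F}}.
  by move/eqP; rewrite -subr_eq0 -scalerBr scale_poly_eq0 (negPf P0) /= subr_eq0 => /eqP.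
have [[g' gE]|[h' hE]] := prime_content pP E Pc.
  have E' : c' *: f = g' * h.
    by apply: cancelP; rewrite scalerA mulrC -cE E gE scalerAl.
  have := IHb c' sc' g' h c'0 E'; rewrite gE => -[s1|]; [left|right] => //.
  by rewrite size_scale.
have E' : c' *: f = g * h'.
  by apply: cancelP; rewrite scalerA mulrC -cE E hE scalerAr.
have := IHb c' sc' g h' c'0 E'; rewrite hE => -[|s1]; [left|right] => //.
by rewrite size_scale.
Qed.

(** For nonconstant [g] the resultant serves: if it vanished, the gcd would be a nonconstant factor
    of [f] of smaller degree. Constant [g] is its own witness. *)
Lemma frac_irreducible_bezout f g : frac_irreducible f -> g != 0 ->
  (size g < size f)%N -> exists r, r != 0 /\ exists u v, r%:P = u * f + v * g.
Proof.
move=> irrf g0 sgf.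
have [g1|g1] := leqP (size g) 1.
  exists g`_0; split; first by rewrite -polyC_eq0 -size1_polyC.
  by exists 0, 1; rewrite mul0r mul1r add0r -size1_polyC.
have f1 : (1 < size f)%N by apply: ltn_trans sgf.
exists (resultant f g); split; last first.
  by have [[u v] _ E] := resultant_in_ideal f1 g1; exists u, v.
rewrite resultant_eq0 -leqNgt; have := dvdp_gcdl f g.
case/Pdiv.Idomain.dvdpP => -[c k] /= c0 E.
have [k1|//] := irrf _ _ _ c0 E.
have f0 : f != 0 by rewrite -size_poly_gt0 ltnW.
have : size (c *: f) = size f by rewrite size_scale.
rewrite E => sE.
have kf0 : k * gcdp f g != 0 by rewrite -size_poly_gt0 sE ltnW.
move: kf0; rewrite mulf_eq0 negb_or => /andP[k0 gc0].
have := dvdp_leq g0 (dvdp_gcdr f g); move: sE; rewrite size_mul // => sE.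
have : size k = 1%N by apply/eqP; rewrite eqn_leq k1 size_poly_gt0.
by move=> sk; move: sE; rewrite sk add1n /= => ->; rewrite leqNgt sgf.
Qed.

(** Modulo [f], some multiple [v * g] equals a nonzero constant [r], whose norm is a power of
    [r]. *)
Lemma frac_irreducible_norm n f g : f \is monic -> size f = n.+2 ->
  frac_irreducible f -> g != 0 -> (size g <= n.+1)%N -> norm_mod n f g != 0.
Proof.
move=> fm sf irrf g0 sg.
have [|r [r0 [u [v E]]]] := frac_irreducible_bezout irrf g0; first by rewrite sf.
have : norm_mod n f (v * g) != 0.
  have -> : v * g = r%:P - u * f by rewrite E addrAC subrr add0r.
  rewrite /norm_mod rmorphB rmorphM /= horner_mulX_mx0 // mulr0 subr0.
  by rewrite horner_mx_C det_scalar expf_neq0.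
by rewrite norm_modM mulf_eq0 negb_or => /andP[].
Qed.

Lemma frac_irreducible_comp f g h c : c != 0 -> c *: f = h \Po g ->
  (1 < size g)%N -> frac_irreducible f -> frac_irreducible h.
Proof.
move=> c0 E sg irrf b k l b0 El.
have := irrf (b * c) (k \Po g) (l \Po g); rewrite mulf_neq0 // => /(_ isT).
rewrite -comp_polyM -El comp_polyZ -scalerA E => /(_ erefl).
have size_comp p : (size (p \Po g) <= 1)%N -> (size p <= 1)%N.
  have [->|p0] := eqVneq p 0; first by rewrite size_poly0.
  have := size_comp_poly p g; case: (size (p \Po g)) => [|[|//]] /= + _.
    move: sg; case: (size g) => [|[]] // k' _; case: (size p) => [|[]] //.
  by move: sg; case: (size g) => [|[]] // k' _; case: (size p) => [|[]].
by case=> /size_comp; [left|right].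
Qed.

(** A zero derivative leaves only exponents divisible by the characteristic [p], so [f] is a
    polynomial in ['X^p] of smaller degree; repeat. *)
Lemma separable_descent f : (1 < size f)%N -> exists m h,
  [/\ (0 < m)%N, ([pchar {poly F}]).-nat m, f = h \Po 'X^m & h^`() != 0].
Proof.
have [p pr_p pF] := finPcharP F.
have pA : p \in [pchar {poly F}] by rewrite pchar_poly.
have p0 := prime_gt0 pr_p; have p1 := prime_gt1 pr_p.
have [b] := ubnP (size f); elim: b f => // b IHb f sb sf.
have [f'0|] := eqVneq f^`() 0; last first.
  by exists 1%N, f; split=> //; rewrite ?expr1 ?comp_polyXr.
pose f1 := \poly_(i < size f) f`_(i * p).
have fE : f = f1 \Po 'X^p.
  apply/polyP => i; rewrite coef_comp_poly_Xn // coef_poly; case: ifP => pi.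
    rewrite divnK //; case: ltnP => // le; rewrite nth_default //.
    by rewrite (leq_trans le) // leq_div.
  case: i pi => [|i]; first by rewrite dvdn0.
  move=> pi; have := congr1 (fun g => g`_i) f'0; rewrite coef_deriv coef0 => /eqP.
  rewrite -mulr_natr mulf_eq0 => /orP[/eqP //|].
  by rewrite -(dvdn_pcharf pA) pi.
have sE : (size f).-1 = ((size f1).-1 * p)%N.
  have := size_comp_poly f1 'X^p; rewrite -fE size_polyXn /= => ->.
  by [].
have sf1 : (1 < size f1)%N.
  by move: sE sf; case: (size f1) => [|[|//]]; rewrite mul0n; case: (size f) => [|[]].
have [|m [h [m0 pm f1E h']]] := IHb f1 _ sf1.
  rewrite -ltnS (leq_trans _ sb) // ltnS.
  have : ((size f1).-1 < (size f).-1)%N.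
    by rewrite sE -[X in (X < _)%N]muln1 ltn_pmul2l //; case: (size f1) sf1 => [|[]].
  by move: sf sf1; case: (size f) => // ?; case: (size f1).
exists (m * p)%N, h; split=> //; first by rewrite muln_gt0 m0.
  by rewrite pnatM pm pnatE.
by rewrite fE f1E -comp_polyA comp_Xn_poly -exprM mulnC.
Qed.

Lemma monicize n h (a := lead_coef h) : size h = n.+2 -> exists h1,
  [/\ h1 \is monic, size h1 = n.+2 & a ^+ n *: h = h1 \Po (a *: 'X)].
Proof.
move=> sh; have a0 : a != 0 by rewrite lead_coef_eq0 -size_poly_gt0 sh.
pose h1 := \poly_(i < n.+2) (if i == n.+1 then 1 else h`_i * a ^+ (n - i)).
have l1 : h1`_n.+1 = 1 by rewrite coef_poly ltnSn eqxx.
have s1 : size h1 = n.+2.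
  by apply/eqP; rewrite size_poly_eq //= eqxx oner_neq0.
exists h1; split=> //; first by rewrite monicE lead_coefE s1 /= l1.
apply/polyP => i; rewrite coefZ comp_polyE.
rewrite coef_sum s1.
under eq_bigr do rewrite exprZn !coefZ coefXn.
have [lt|le] := ltnP i n.+2; last first.
  rewrite nth_default ?sh // mulr0 big1 // => j _.
  by rewrite gtn_eqF ?mulr0 // (leq_trans (ltn_ord j)).
rewrite (bigD1 (Ordinal lt)) //= eqxx mulr1 big1 ?addr0; last first.
  move=> j; rewrite -val_eqE /= => ji; rewrite eq_sym (negPf ji) !mulr0 //.
rewrite coef_poly lt; case: eqP => [->|/eqP ni].
  by rewrite mul1r exprSr [h`_n.+1](_ : _ = a) // /a lead_coefE sh.
rewrite -mulrA -exprD subnK 1?mulrC //.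
by move: lt; rewrite ltnS leq_eqVlt (negPf ni).
Qed.

Lemma dvdp_horner_sub h P x y : P %| x - y -> P %| h.[x] - h.[y].
Proof.
move=> Pxy; have [c] := horner_taylor2 h y (x - y).
rewrite [y + _]addrC subrK => E.
have -> : h.[x] - h.[y] = h^`().[y] * (x - y) + (x - y) ^+ 2 * c.
  by rewrite E; ring.
by apply: dvdp_add; [apply: dvdp_mull | rewrite expr2 -mulrA dvdp_mulr].
Qed.

(** The map from [x] to [a * x ^+ m] is injective modulo [P]: as [m] is a power of the
    characteristic, the difference of two images is [a * (x - y) ^+ m]. *)
Lemma root_count_comp f h1 P a n m : prime_poly P -> ~~ (P %| a) ->
  (0 < m)%N -> ([pchar {poly F}]).-nat m ->
  (forall x, a ^+ n * f.[x] = h1.[a * x ^+ m]) ->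
  root_count f P = root_count h1 P.
Proof.
move=> pP Pa m0 pm E; set r := degp P.
have smod x : (size (x %% P)%R <= r)%N.
  by rewrite -ltnS -prime_poly_size // ltn_modp prime_poly_neq0.
pose phi (x : {poly_r F}) : {poly_r F} := NPoly (smod (a * val x ^+ m)).
have phiE x : P %| a * val x ^+ m - val (phi x).
  by rewrite /= {1}(divp_eq (a * _) P) addrK dvdp_mull.
have phiI : injective phi.
  move=> x y /(congr1 val) xy; apply: val_inj; apply/eqP; rewrite -subr_eq0.
  have : P %| a * (val x - val y) ^+ m.
    rewrite exprDn_pchar // exprNn_pchar // mulrBr.
    have -> : a * val x ^+ m - a * val y ^+ m =
      (a * val x ^+ m - val (phi x)) - (a * val y ^+ m - val (phi y)).
      by rewrite xy opprB addrA addrNK.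
    by rewrite dvdp_sub.
  rewrite prime_poly_dvdM // (negPf Pa) /= => /(prime_poly_dvdX pP) Pxy.
  apply: contraTT Pxy => nz; apply/negP => /(dvdp_leq nz).
  rewrite (prime_poly_size pP) leqNgt => /negP; apply; rewrite ltnS.
  by rewrite (leq_trans (size_polyD _ _)) // size_polyN geq_max !size_npoly.
rewrite /root_count -[RHS](card_preimset _ phiI); apply: eq_card => x.
rewrite !finset.in_set.
have -> : (P %| h1.[val (phi x)]) = (P %| h1.[a * val x ^+ m]).
  have Puv := dvdp_horner_sub h1 (phiE x).
  apply/idP/idP => Pu.
    by rewrite -[h1.[a * _]](subrK h1.[val (phi x)]) dvdp_add.
  by rewrite -[h1.[val (phi x)]](subKr h1.[a * val x ^+ m]) dvdp_sub.
rewrite -E prime_poly_dvdM //; case: (boolP (P %| a ^+ n)) => //=.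
by move/(prime_poly_dvdX pP); rewrite (negPf Pa).
Qed.

End GenericIrreducible.

(** * The Mertens-type bound in asymptotic form *)

Section MertensAsymptotic.
Variables (F : finFieldType) (R : realType).
Local Notation q := #|F|.
Local Notation Q := (q%:R : R).
Implicit Types (f : {poly {poly F}}) (P : {poly F}).

Lemma ler_nat_expn k : k%:R <= Q ^+ k.
Proof. by rewrite -natrX ler_nat ltnW // ltn_expl // card_finNzRing_gt1. Qed.

Lemma div_expn_small (x eps : R) : 0 <= x -> 0 < eps ->
  exists b, forall k, (b <= k)%N -> x / Q ^+ k <= eps.
Proof.
move=> x0 eps0; exists (Num.bound (x / eps)) => k bk.
have Qk : 0 < Q ^+ k by rewrite exprn_gt0 // natr_card_gt0.
rewrite ler_pdivrMr // mulrC -ler_pdivrMr //; apply: le_trans (ler_nat_expn k).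
apply: (@le_trans _ _ (Num.bound (x / eps))%:R); last by rewrite ler_nat.
by apply/ltW/archi_boundP; rewrite divr_ge0 // ltW.
Qed.

Lemma sum_root_weight_mono f a M N : (M <= N)%N ->
  \sum_(P <- primes_upto F M | (a < degp P)%N) root_weight f R P <=
  \sum_(P <- primes_upto F N | (a < degp P)%N) root_weight f R P.
Proof.
move=> MN; rewrite -(big_primes_upto_le _ _ _ MN).
rewrite [X in _ <= X](bigID (fun P => (degp P <= M)%N)) /= lerDl.
by apply: sumr_ge0 => P _; apply: root_weight_ge0.
Qed.

Lemma mertens_monic n f (eps : R) a0 : f \is monic -> size f = n.+2 ->
  frac_irreducible f -> f^`() != 0 -> 0 < eps ->
  exists C : R, forall N, (1 - eps) * N%:R - C <=
    \sum_(P <- primes_upto F N | (a0 < degp P)%N) root_weight f R P.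
Proof.
move=> fm sf irrf f'0 eps0.
have sum_ge0 N a : 0 <= \sum_(P <- primes_upto F N | (a < degp P)%N) root_weight f R P.
  by apply: sumr_ge0 => P _; apply: root_weight_ge0.
have [eps1|eps1] := lerP 1 eps.
  exists 0 => N; rewrite subr0; apply: le_trans (sum_ge0 N a0).
  by rewrite mulr_le0_ge0 // subr_le0.
have [|delta [delta0 disc]] := frac_irreducible_bezout irrf f'0.
  by apply: lt_size_deriv; rewrite -size_poly_gt0 sf.
have N0 g := @frac_irreducible_norm F n f g fm sf irrf.
have [c sizeN] := size_norm_mod_bound n f.
have ME := mertens_explicit fm sf delta0 disc N0 sizeN R.
set d := n.+1 in ME *; pose thr := (q * (d * c.+1))%N; pose K := Q ^+ (d * c.+1).
have K0 : 0 <= K by rewrite exprn_ge0.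
have e3 : 0 < eps / 3 by rewrite divr_gt0.
have [b1 hb1] := @div_expn_small ((d ^ 2)%:R * K) _ (mulr_ge0 (ler0n _ _) K0) e3.
(* The order of choices matters: [a] comes first, since the exponent bound [b2] depends on the
   number of primes of degree at most [a]. Each of the three errors is at most [eps / 3]. *)
pose a := maxn b1 (maxn a0 (degp delta)).
have [b2 hb2] := @div_expn_small ((size (primes_upto F a))%:R * d%:R) _ (mulr_ge0 (ler0n _ _) (ler0n _ _)) e3.
have [s hs] := @div_expn_small d%:R _ (ler0n _ _) e3.
pose C2 := (\sum_(P <- primes_upto F a) d * b2 * degp P)%N.
pose C3 := K * d%:R * (d * (c + thr))%:R.
exists (C2%:R + C3 + (d * (s + b2.+1 * a).+1)%:R) => N.
set k := (N %/ d)%N.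
have Nk : (N <= d * k + d)%N.
  by rewrite [X in (X <= _)%N](divn_eq N d) mulnC leq_add2l ltnW // ltn_pmod.
have C30 : 0 <= C3 by rewrite !mulr_ge0.
(* For small [k] the constant makes the left-hand side nonpositive. *)
have [small|large] := ltnP k (s + b2.+1 * a).
  apply: le_trans (sum_ge0 N a0); rewrite subr_le0.
  apply: (@le_trans _ _ (d * (s + b2.+1 * a).+1)%:R); last by rewrite lerDr addr_ge0.
  apply: (@le_trans _ _ N%:R); first by rewrite ler_piMl // lerBlDr lerDl ltW.
  rewrite ler_nat (leq_trans Nk) // -mulnSr leq_mul2l ltnS (ltnW small) orbT //.
have da : (degp delta <= a)%N by rewrite !leq_max leqnn !orbT.
have h3 : (s <= k + thr)%N.
  by rewrite (leq_trans _ (leq_addr _ _)) // (leq_trans _ large) // leq_addr.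
have h4 : (b2.+1 * a <= k + thr)%N.
  by rewrite (leq_trans _ (leq_addr _ _)) // (leq_trans _ large) // leq_addl.
(* With box level [k + thr], the main sum stops at degree [d * k], which is at most [N]. *)
have := ME a b2 s (k + thr)%N da (leq_addl _ _) h3 h4.
rewrite addnK -/K -/C2 -/thr -/C3; set e2 := (size _)%:R * _.
set e3' := _ / Q ^+ a; set e4 := _ / Q ^+ s.
set D := (d * _)%:R; set S := \sum_(P <- _ | _) _.
set T := \sum_(P <- _ | _) _ => main.
have e2_le : e2 <= eps / 3 by rewrite /e2 mulrA; apply: hb2.
have e3_le : e3' <= eps / 3 by apply: hb1; rewrite leq_max leqnn.
have e4_le : e4 <= eps / 3 by apply: hs.
have ST : S <= T.
  apply: le_trans (_ : \sum_(P <- primes_upto F N | (a < degp P)%N) root_weight f R P <= _).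
    by apply: sum_root_weight_mono; rewrite /k mulnC leq_trunc_div.
  rewrite /T [X in _ <= X](bigID (fun P => (a < degp P)%N)) /=.
  rewrite [X in _ <= X + _](eq_bigl (fun P => (a < degp P)%N)); last first.
    move=> P; case: (ltnP a (degp P)) => aP; rewrite ?andbF // andbT.
    by apply: leq_ltn_trans aP; rewrite !leq_max leqnn orbT.
  by rewrite lerDl; apply: sumr_ge0 => P _; apply: root_weight_ge0.
have D0 : 0 <= D by [].
have ND : N%:R <= D + (d * s.+1)%:R.
  rewrite /D -natrD ler_nat (leq_trans Nk) // -mulnSr -mulnDr leq_mul2l.
  by rewrite addnS ltnS subnK // leq_addr orbT.
have dd : (d * s.+1)%:R <= (d * (s + b2.+1 * a).+1)%:R :> R.
  by rewrite ler_nat leq_mul2l ltnS leq_addr orbT.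
have d0 : 0 <= (d * s.+1)%:R :> R by [].
have h1 : D * (1 - eps) <= D * (1 - (e2 + e3' + e4)) by apply: ler_wpM2l => //; lra.
have h2 : (1 - eps) * N%:R <= (1 - eps) * (D + (d * s.+1)%:R) by apply: ler_wpM2l => //; lra.
have h5 : (1 - eps) * (d * s.+1)%:R <= (d * s.+1)%:R by rewrite ler_piMl //; lra.
rewrite mulrDr in h2; rewrite mulrC in h1.
move: main h1 h2 h5 dd ST; set u := _ * N%:R; set v := (1 - eps) * D; set w := (1 - eps) * _.
set x := D * _; set y := (d * s.+1)%:R; set z := (d * _.+1)%:R; lra.
Qed.

(* Both changes of variable, [X := X^m] with [m] a power of the characteristic
   and the scaling by the leading coefficient [a], permute the residues modulo
   any prime not dividing [a]. *)
Lemma mertens f (eps : R) : frac_irreducible f -> (1 < size f)%N -> 0 < eps ->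
  exists C : R, forall N, (1 - eps) * N%:R - C <=
    \sum_(P <- primes_upto F N) root_weight f R P.
Proof.
move=> irrf sf eps0.
have [m [h [m0 pm fE h'0]]] := separable_descent sf.
have sm : (1 < size ('X^m : {poly {poly F}}))%N by rewrite size_polyXn ltnS.
have irrh : frac_irreducible h.
  apply: (@frac_irreducible_comp _ f 'X^m h 1) => //; first exact: oner_neq0.
  by rewrite scale1r.
have sh : (1 < size h)%N.
  rewrite ltnNge; apply: contra h'0 => h1.
  by rewrite (size1_polyC h1) derivC.
have [n sn] : exists n, size h = n.+2 by case: (size h) sh => [|[|n]] // _; exists n.
have [h1 [h1m sh1 h1E]] := monicize sn.
set a := lead_coef h in h1E.
have a0 : a != 0 by rewrite lead_coef_eq0 -size_poly_gt0 sn.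
have an0 : a ^+ n != 0 by rewrite expf_neq0.
have sa : size (a *: 'X : {poly {poly F}}) = 2%N by rewrite size_scale // size_polyX.
have irrh1 : frac_irreducible h1.
  by apply: (frac_irreducible_comp an0 h1E _ irrh); rewrite sa.
have h1'0 : h1^`() != 0.
  apply: contraNneq h'0 => z; have := congr1 (fun p => p^`()) h1E.
  rewrite derivZ deriv_comp z comp_poly0 mul0r => /eqP.
  by rewrite scale_poly_eq0 (negPf an0).
have [C hC] := mertens_monic (degp a) h1m sh1 irrh1 h1'0 eps0.
exists C => N; apply: le_trans (hC N) _.
rewrite [X in _ <= X](bigID (fun P => (degp a < degp P)%N)) /=.
rewrite -[X in X <= _]addr0 lerD //; last first.
  by apply: sumr_ge0 => P _; apply: root_weight_ge0.
rewrite big_seq_cond [X in _ <= X]big_seq_cond; apply: ler_sum => P.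
rewrite mem_primes_upto => /andP[/andP[pP _] aP].
rewrite /root_weight (@root_count_comp F f h1 P a n m) //.
  apply/negP => /(degp_dvd a0); rewrite leqNgt => /negP; exact.
by move=> x; rewrite fE horner_comp hornerXn -hornerZ h1E horner_comp !hornerE.
Qed.

End MertensAsymptotic.

Lemma asymp_leP (R : realType) (A B : nat -> R) :
  (forall eps : R, 0 < eps ->
    exists n0, forall n, (n0 <= n)%N -> A n / B n <= 1 + eps) -> asymp_le A B.
Proof.
move=> H; apply/lee_addgt0Pr => eps eps0; have [n0 hn0] := H eps eps0.
apply: ereal_inf_le; exists (ereal_sup [set (A n / B n)%:E | n in [set n | (n0 <= n)%N]]%classic).
  by exists [set n | (n0 <= n)%N]%classic => //; exact: nbhs_infty_ge.
by apply: ge_ereal_sup => _ [n /= nn0 <-]; rewrite -EFinD lee_fin hn0.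
Qed.

(** * Values of [f] at monic polynomials and the degree of their lcm *)

Section Values.
Variable F : finFieldType.
Implicit Types (f : {poly {poly F}}) (P a : {poly F}) (n : nat).
Local Notation q := #|F|.

Lemma mem_monic_of_deg n (Q : {poly_(n.+1) F}) : Q \in monic_of_deg F n ->
  val Q \is monic /\ size (val Q) = n.+1.
Proof.
rewrite finset.in_set => /andP[Qm /eqP dQ]; split=> //.
by rewrite -[RHS](congr1 S dQ) /degp prednK // size_poly_gt0 monic_neq0.
Qed.

Lemma card_monic_of_deg_le n : (#|monic_of_deg F n| <= q ^ n)%N.
Proof.
rewrite -card_npoly; pose h (Q : {poly_(n.+1) F}) := npolyp n (val Q).
rewrite -(@card_in_imset _ _ h) ?max_card // => Q Q'.
move=> /mem_monic_of_deg[Qm sQ] /mem_monic_of_deg[Q'm sQ'] /(congr1 val) E.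
apply: val_inj; apply/polyP => i; have [lt|] := ltnP i n.
  by have := congr1 (fun p : {poly F} => p`_i) E; rewrite /= !coef_npolyp lt.
rewrite leq_eqVlt => /orP[/eqP <-|lt]; last by rewrite !nth_default ?sQ ?sQ'.
by move: Qm Q'm; rewrite !monicE !lead_coefE sQ sQ' => /eqP -> /eqP ->.
Qed.

Lemma degp_horner_le f : exists c, forall n (Q : {poly_(n.+1) F}),
  (degp f.[val Q] <= degp f * n + c)%N.
Proof.
exists (\max_(i < size f) size (f`_i)%R)%N => n Q.
set K := (X in (_ <= X)%N); suff : (size f.[val Q] <= K.+1)%N.
  by rewrite /degp; case: (size f.[val Q]).
rewrite horner_coef; apply: leq_trans (size_sum _ _ _) _; apply/bigmax_leqP => i _.
apply: leq_trans (size_polyMleq _ _) _.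
have h1 : (size (f`_i)%R <= \max_(i < size f) size (f`_i)%R)%N.
  exact: (leq_bigmax (F := fun i : 'I_(size f) => size (f`_i)%R)).
have h2 : (size (val Q ^+ i)%R <= ((size f).-1 * n).+1)%N.
  apply: leq_trans (size_poly_exp_leq _ _) _; rewrite ltnS mulnC leq_mul //.
    by rewrite -ltnS (leq_trans (ltn_ord i)) // leqSpred.
  by rewrite -subn1 leq_subLR add1n size_npoly.
apply: leq_trans (leq_pred _) _; rewrite addnC /K -addSn; exact: leq_add.
Qed.

(** Each root [x] modulo [P] yields the distinct arguments [P * ('X^(n - degp P) + w) + x], with [w]
    of degree less than [n - degp P]. *)
Lemma card_monic_root f P n : prime_poly P -> (degp P <= n)%N ->
  (root_count f P * q ^ (n - degp P) <=
   #|[set Q in monic_of_deg F n | (P %| f.[val Q])%R]|)%N.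
Proof.
move=> pP Pn; rewrite -card_npoly -[X in (_ * X)%N]cardsT -cardsX.
set r := degp P; set T := {poly_(n - r) F}.
pose g (p : {poly_r F} * T) : {poly F} := P * ('X^(n - r) + val p.2) + val p.1.
have mon (w : T) : 'X^(n - r) + val w \is monic.
  by rewrite monicE lead_coefDl ?lead_coefXn // size_polyXn ltnS size_npoly.
have smon (w : T) : size ('X^(n - r) + val w) = (n - r).+1.
  by rewrite size_polyDl size_polyXn // ltnS size_npoly.
have sPm (w : T) : size (P * ('X^(n - r) + val w)) = n.+1.
  by rewrite size_Mmonic ?prime_poly_neq0 // smon prime_poly_size // addnS addSn /= subnKC.
have lt (p : {poly_r F} * T) : (size (val p.1) < size (P * ('X^(n - r) + val p.2))%R)%N.
  by rewrite sPm ltnS (leq_trans (size_npoly _)).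
have sg p : size (g p) = n.+1 by rewrite /g size_polyDl // sPm.
have gm p : g p \is monic.
  by rewrite monicE /g lead_coefDl // lead_coef_Mmonic // -monicE prime_poly_monic.
have sg' p : (size (g p) <= n.+1)%N by rewrite sg.
pose h p : {poly_(n.+1) F} := NPoly (sg' p).
have hI : injective h.
  move=> [x w] [x' w'] /(congr1 val); rewrite /= /g /= => E.
  have sx (z : {poly_r F}) : (size (val z) < size P)%N.
    by rewrite (prime_poly_size pP) ltnS size_npoly.
  have xx : x = x'.
    apply: val_inj; have := congr1 (fun u => u %% P) E.
    by rewrite /= !modpD !modp_mulr !add0r !modp_small ?sx //.
  move: E; rewrite xx => /addIr/(mulfI (prime_poly_neq0 pP))/addrI/val_inj -> //.
rewrite -(card_imset _ hI); apply: subset_leq_card; apply/fintype.subsetP => Q.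
case/imsetP => -[x w]; rewrite finset.in_setX !finset.in_set /= => /andP[fx _] ->.
rewrite gm /degp sg eqxx /=.
have Pd : P %| g (x, w) - val x by rewrite /g /= addrK dvdp_mulr.
by rewrite -[f.[_]](subrK f.[val x]) dvdp_add // dvdp_horner_sub.
Qed.

(** The lcm divides one product of small prime powers times the cofactors of the distinct values.
    Repetition of values divides the cofactor degree by [c], and [card_monic_root] bounds below the
    degree removed by the small primes. *)
Lemma degp_Lf_le f n c D (s := primes_upto F n) :
  (forall Q : {poly_(n.+1) F}, f.[val Q] != 0 /\ (degp f.[val Q] <= D)%N) ->
  (forall a, a \in [seq f.[val Q] | Q <- enum (monic_of_deg F n)] ->
    (c <= count_mem a [seq f.[val Q] | Q <- enum (monic_of_deg F n)])%N) ->
  (c * degp (Lf f n) + \sum_(P <- s) degp P * (root_count f P * q ^ (n - degp P))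
    <= c * (size s * D) + D * q ^ n)%N.
Proof.
move=> fQ hc; set vals := [seq _ | Q <- _] in hc.
have us : uniq s by apply: primes_upto_uniq.
have ps : all (@prime_poly F) s by apply: all_primes_upto.
(* The cofactor is chosen as a function of the value, so that equal values share it; 0 is a dummy
   where the conditions fail. *)
have /choice[b hb] : forall a, exists b, a != 0 -> (degp a <= D)%N ->
  [/\ b != 0, a %| b * \prod_(P <- s) P ^+ (D %/ degp P) &
    (degp b + \sum_(P <- s | (P %| a)%R) degp P <= degp a)%N].
  move=> a; have [->|a0] := eqVneq a 0; first by exists 0.
  have [aD|aD] := leqP (degp a) D; last by exists 0.
  by have [b hb] := prime_poly_cofactor us ps a0 aD; exists b.
set Z := \prod_(P <- s) _ in hb.
have hbQ (Q : {poly_(n.+1) F}) := hb f.[val Q] (fQ Q).1 (fQ Q).2.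
have Z0 : Z != 0.
  rewrite prodf_seq_neq0; apply/allP => P /(allP ps) pP /=.
  by rewrite expf_neq0 // prime_poly_neq0.
have vb0 a : a \in vals -> b a != 0 by case/mapP => Q _ ->; case: (hbQ Q).
have dZ : (degp Z <= size s * D)%N.
  rewrite degp_prod; last by move=> P /(allP ps) pP; rewrite expf_neq0 // prime_poly_neq0.
  apply: (@leq_trans (\sum_(P <- s) D)%N).
    by apply: leq_sum => P _; rewrite degpX mulnC leq_trunc_div.
  by rewrite big_const_seq count_predT iter_addn_0 mulnC.
pose W := \prod_(a <- undup vals) b a.
have W0 : W != 0 by rewrite prodf_seq_neq0; apply/allP => a; rewrite mem_undup => /vb0.
have LZ : Lf f n %| Z * W.
  rewrite dvdp_biglcm; apply/forall_inP => Q QM.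
  have [b0 db _] := hbQ Q; apply: dvdp_trans db _; rewrite mulrC dvdp_mul2l //.
  have Qv : f.[val Q] \in undup vals.
    by rewrite mem_undup; apply/mapP; exists Q; rewrite ?mem_enum.
  by rewrite /W (big_rem _ Qv) /= dvdp_mulr.
have dL : (degp (Lf f n) <= degp Z + \sum_(a <- undup vals) degp (b a))%N.
  rewrite -degp_prod; last by move=> a; rewrite mem_undup => /vb0.
  by rewrite -degpM //; apply: degp_dvd LZ; rewrite mulf_neq0.
(* Summing over all arguments counts each distinct value with its multiplicity, at least [c]. *)
have fib : (c * \sum_(a <- undup vals) degp (b a) <=
    \sum_(Q in monic_of_deg F n) degp (b f.[val Q]))%N.
  have -> : (\sum_(Q in monic_of_deg F n) degp (b f.[val Q]) = \sum_(a <- vals) degp (b a))%N.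
    by rewrite big_map big_enum.
  rewrite -[X in (_ <= X)%N]big_undup_iterop_count big_distrr /=.
  rewrite big_seq [X in (_ <= X)%N]big_seq; apply: leq_sum => a.
  rewrite mem_undup => av; rewrite Monoid.iteropE iter_addn_0 mulnC leq_mul2l.
  by rewrite hc ?orbT.
have small : (\sum_(P <- s) degp P * (root_count f P * q ^ (n - degp P)) <=
    \sum_(Q in monic_of_deg F n) \sum_(P <- s | (P %| f.[val Q])%R) degp P)%N.
  rewrite (exchange_big_dep xpredT) //= big_seq [X in (_ <= X)%N]big_seq.
  apply: leq_sum => P; rewrite mem_primes_upto => /andP[pP Pn].
  rewrite sum_nat_const mulnC leq_mul2r; apply/orP; right.
  apply: leq_trans (card_monic_root f pP Pn) _; apply: subset_leq_card.
  by apply/fintype.subsetP => Q; rewrite finset.in_set.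
have tot : (\sum_(Q in monic_of_deg F n) degp (b f.[val Q]) +
    \sum_(Q in monic_of_deg F n) \sum_(P <- s | (P %| f.[val Q])%R) degp P <= D * q ^ n)%N.
  rewrite -big_split /=; apply: (@leq_trans (\sum_(Q in monic_of_deg F n) D)%N).
    apply: leq_sum => Q _; have [_ _ le] := hbQ Q.
    by apply: leq_trans le (fQ Q).2.
  by rewrite sum_nat_const mulnC leq_mul2l card_monic_of_deg_le orbT.
have : (c * degp (Lf f n) <= c * (size s * D) + c * \sum_(a <- undup vals) degp (b a))%N.
  by rewrite -mulnDr leq_mul2l (leq_trans dL) ?orbT // leq_add2r.
move: fib small tot; lia.
Qed.

End Values.

(** * Sparsity of the primes, multiplicity of the values, and the conclusion *)

Section Density.
Variables (F : finFieldType) (R : realType).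
Local Notation q := #|F|.
Local Notation Q := (q%:R : R).

(** Primes of degree at most a fixed [k] are finite in number; those beyond are at most
    [2 * Q ^+ n / k%:R] by a geometric sum. *)
Lemma primes_density (eps : R) : 0 < eps -> exists n0, forall n, (n0 <= n)%N ->
  (size (primes_upto F n))%:R <= eps * Q ^+ n.
Proof.
move=> eps0; have Q0 := natr_card_gt0 F R; have Q2 := natr_card_ge2 F R.
have QX0 r : 0 < Q ^+ r by rewrite exprn_gt0.
have e2 : 0 < eps / 2 by rewrite divr_gt0.
pose k := (Num.bound (4 / eps)).+1.
have kbig : 2 / k%:R <= eps / 2.
  rewrite ler_pdivrMr ?ltr0n // mulrC -ler_pdivrMr //.
  have -> : 2 / (eps / 2) = 4 / eps by field; rewrite gt_eqF.
  apply: le_trans (_ : (Num.bound (4 / eps))%:R <= _); last by rewrite ler_nat.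
  by apply/ltW/archi_boundP; rewrite divr_ge0 // ltW.
have [n1 hn1] := @div_expn_small F R (size (primes_upto F k))%:R _ (ler0n _ _) e2.
exists (maxn k n1) => n; rewrite geq_max => /andP[kn n1n].
have := hn1 n n1n; rewrite ler_pdivrMr // => small.
have geom j : \sum_(k.+1 <= r < j.+1) Q ^+ r <= 2 * Q ^+ j.
  elim: j => [|j IHj]; first by rewrite big_geq // mulr_ge0 ?ltW.
  have [kj|jk] := leqP k.+1 j.+1; last by rewrite big_geq // mulr_ge0 ?ltW.
  rewrite big_nat_recr //= exprS.
  have : 2 * Q ^+ j <= Q * Q ^+ j by rewrite ler_pM2r.
  by move: IHj; set u := \sum_(_ <= _ < _) _; set v := Q * _; lra.
have large : \sum_(P <- primes_upto F n | (k < degp P)%N) (1 : R) <= eps / 2 * Q ^+ n.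
  apply: le_trans (@sum_primes_le F R k n (fun=> 1) (fun=> ler01)) _.
  apply: (@le_trans _ _ (\sum_(k.+1 <= r < n.+1) Q ^+ r / k%:R)).
    rewrite big_nat [X in _ <= X]big_nat; apply: ler_sum => r /andP[kr _].
    rewrite mul1r ler_pM2l // lef_pV2 ?posrE ?ltr0n //; first by rewrite ler_nat ltnW.
    exact: leq_ltn_trans kr.
  rewrite -mulr_suml; apply: le_trans (_ : 2 * Q ^+ n / k%:R <= _).
    by rewrite ler_pM2r ?invr_gt0 ?ltr0n.
  by rewrite mulrAC ler_pM2r.
have -> : (size (primes_upto F n))%:R = \sum_(P <- primes_upto F n) (1 : R).
  by rewrite big_const_seq count_predT iter_addr_0.
rewrite (bigID (fun P => (degp P <= k)%N)) /=.
rewrite (@big_primes_upto_le F R 0 _ (fun=> 1) predT k n kn).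
rewrite big_const_seq count_predT iter_addr_0.
under eq_bigl do rewrite -ltnNge.
by move: small large; set u := \sum_(_ <- _ | _) _; set v := Q ^+ n; lra.
Qed.

End Density.

(** Translating an argument by an element of [Vf f] keeps the value, and keeps it monic of degree
    [n] once [n] bounds the sizes of all elements of [Vf f]. *)
Lemma Vf_values_count (F : finFieldType) (f : {poly {poly F}}) :
  (1 < size f)%N -> exists n0, forall n, (n0 <= n)%N ->
  forall a, a \in [seq f.[val Q] | Q <- enum (monic_of_deg F n)] ->
  (#|` fset_set (Vf f)| <=
    count_mem a [seq f.[val Q] | Q <- enum (monic_of_deg F n)])%N.
Proof.
move=> sf; have finV := finite_Vf sf; set V := fset_set (Vf f).
have VP g : g \in enum_fset V -> Vf f g.
  by move=> gV; apply: set_mem; rewrite -in_fset_set.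
exists (\max_(g <- enum_fset V) size g)%N => n nn a /mapP[Q0 + ->].
rewrite mem_enum => /mem_monic_of_deg[Q0m sQ0].
have sg g : g \in enum_fset V -> (size g < size (val Q0))%N.
  move=> gV; rewrite sQ0 ltnS; apply: leq_trans nn.
  exact: (leq_bigmax_seq (F := fun g : {poly F} => size g)).
rewrite count_map -size_filter -(size_map val) -(size_map (+%R (val Q0))).
apply: uniq_leq_size; first by rewrite map_inj_uniq ?fset_uniq //; apply: addrI.
move=> _ /mapP[g gV ->].
have fg : f.[val Q0 + g] = f.[val Q0].
  have := congr1 (fun p => p.[val Q0]) (VP g gV).
  by rewrite horner_comp !hornerE.
have /monic_of_degP[Q QM QE] : (val Q0 + g \is monic) && (degp (val Q0 + g) == n).
  by rewrite monicE lead_coefDl ?sg // -monicE Q0m /degp size_polyDl ?sg // sQ0 eqxx.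
apply/mapP; exists Q => //; rewrite mem_filter mem_enum QM andbT /=.
by apply/eqP; rewrite -fg -QE.
Qed.

Lemma Vf0 (F : finFieldType) (f : {poly {poly F}}) : Vf f 0.
Proof. by rewrite /Vf /= addr0 comp_polyXr. Qed.

Unset Implicit Arguments.

Theorem theorem1p3 (R : realType) (F : finFieldType) (f : {poly {poly F}})
    (f_irr : irreducible_elt f) (d_ge2 : (2 <= degp f)%N) :
  asymp_le (fun n : nat => (degp (Lf f n))%:R : R)
           (fun n : nat => cf R f * ((degp f)%:R - 1) * n%:R * #|F|%:R ^+ n).
Proof.
have sf : (1 < size f)%N by move: d_ge2; rewrite /degp; case: (size f) => [|[]].
pose V := #|` fset_set (Vf f)|.
have V0 : (0 < V)%N.
  have : 0 \in fset_set (Vf f).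
    by rewrite in_fset_set; [apply: mem_set; apply: Vf0 | apply: finite_Vf].
  by move=> V_0; rewrite /V -has_predT; apply/hasP; exists 0.
have Vr0 : 0 < V%:R :> R by rewrite ltr0n.
have Q0 := natr_card_gt0 F R; set Q := #|F|%:R in Q0 *.
have [c hc] := degp_horner_le f; set d := degp f in d_ge2 hc *.
have d1 : 1 <= d%:R - 1 :> R by rewrite lerBrDr -(natrD R 1 1) ler_nat.
apply: asymp_leP => eps eps0.
have e3 : 0 < eps / 3 by rewrite divr_gt0.
have [C hC] := mertens (irreducible_elt_frac f_irr) sf e3.
have dc0 : 0 < V%:R * (d + c)%:R :> R by rewrite mulr_gt0 // ltr0n addn_gt0 (ltnW d_ge2).
(* This density makes the small-prime term [V * size s * D] at most [eps / 3 * n * Q ^ n], as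
   [D <= (d + c) * n]. *)
have [n1 hn1] := @primes_density F R (eps / 3 / (V%:R * (d + c)%:R)) (divr_gt0 e3 dc0).
have [n2 hn2] := Vf_values_count sf.
pose n3 := Num.bound ((c%:R + `|C|) / (eps / 3)).
exists (maxn 1 (maxn n1 (maxn n2 n3))) => n; rewrite !geq_max => /and4P[n_gt0 nn1 nn2 nn3].
have nr0 : 0 < n%:R :> R by rewrite ltr0n.
have X0 : 0 < Q ^+ n by rewrite exprn_gt0.
pose D := (d * n + c)%N.
have key := @degp_Lf_le F f n V D _ (hn2 n nn2).
have {}key := key (fun T => conj (irreducible_horner_neq0 (val T) f_irr d_ge2) (hc n T)).
set L := degp (Lf f n) in key *; set s := primes_upto F n in key.
have hS : (\sum_(P <- s) degp P * (root_count f P * #|F| ^ (n - degp P)))%:R =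
    Q ^+ n * \sum_(P <- s) root_weight f R P.
  rewrite natr_sum mulr_sumr; apply: eq_big_seq => P.
  rewrite mem_primes_upto => /andP[_ Pn]; rewrite /root_weight !natrM natrX.
  have -> : Q ^+ n = Q ^+ (n - degp P) * Q ^+ degp P by rewrite -exprD subnK.
  have : Q ^+ degp P != 0 by rewrite expf_neq0 // gt_eqF.
  by move=> Qd; rewrite -/Q; field.
have {}key : V%:R * L%:R + Q ^+ n * \sum_(P <- s) root_weight f R P <=
    V%:R * ((size s)%:R * D%:R) + D%:R * Q ^+ n.
  by rewrite -hS -natrX -!natrM -!natrD ler_nat.
have dens := hn1 n nn1; rewrite -/s -/Q in dens.
have Dn : D%:R <= (d + c)%:R * n%:R :> R.
  by rewrite -natrM ler_nat /D mulnDl leq_add2l leq_pmulr.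
have hn3 : c%:R + `|C| <= eps / 3 * n%:R.
  rewrite mulrC -ler_pdivrMr //; apply: le_trans (_ : n3%:R <= _); last by rewrite ler_nat.
  by apply/ltW/archi_boundP; rewrite divr_ge0 ?addr_ge0 // ltW.
have small : V%:R * ((size s)%:R * D%:R) <= eps / 3 * n%:R * Q ^+ n.
  have -> : eps / 3 * n%:R * Q ^+ n =
    V%:R * (eps / 3 / (V%:R * (d + c)%:R) * Q ^+ n * ((d + c)%:R * n%:R)).
    have dc1 : (d + c)%:R != 0 :> R by rewrite pnatr_eq0 gtn_eqF // addn_gt0 (ltnW d_ge2).
    have V1 : V%:R != 0 :> R by rewrite gt_eqF.
    by move: (d + c)%:R dc1 (V%:R : R) V1 => u u0 v v0; field; rewrite u0 v0.
  by rewrite ler_pM2l // ler_pM.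
have sumS : (1 - eps / 3) * n%:R - `|C| <= \sum_(P <- s) root_weight f R P.
  by apply: le_trans (hC n); rewrite lerD2l lerN2 ler_norm.
have DE : D%:R = d%:R * n%:R + c%:R :> R by rewrite natrD natrM.
(* The small primes, the Mertens loss and the constants [c] and [C] each cost [eps / 3 * n * Q ^ n];
   since [d - 1] is at least 1, the total fits in the relative error [eps]. *)
have bound : V%:R * L%:R <= (1 + eps) * ((d%:R - 1) * n%:R * Q ^+ n).
  set W := \sum_(P <- s) _ in key sumS.
  have h1 := ler_wpM2l (ltW X0) sumS.
  have h2 := ler_wpM2l (ltW X0) hn3.
  have h3 : eps * n%:R * Q ^+ n <= (d%:R - 1) * (eps * n%:R * Q ^+ n).
    by rewrite ler_peMl // !mulr_ge0 // ltW.
  clear sumS; rewrite DE in key small; move: key h1 h2 h3 small.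
  set x := V%:R * L%:R; set y := V%:R * (_ * _); nra.
rewrite ler_pdivrMr.
  rewrite /cf -/V -!mulrA mulrCA ler_pdivlMl //.
  by move: bound; rewrite !mulrA.
by rewrite !mulr_gt0 // ?invr_gt0 // (lt_le_trans _ d1).
Qed.
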